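(* Let the data $\ell,\alpha,T,\beta,\mu,u_0,u_\partial,\underline u,\overline u$ satisfy the standing assumptions stated in the context. Then there is a constant $C=C(T)$, depending only on the problem data (including $T$) but independent of the discretization parameters $h$ and $\tau$, such that for every mesh size $h=\ell/N$ ($N\in\mathbb N$, $N\ge 1$) and every time step $\tau>0$, the unique solution $(u_h^k)_{k\ge 0}$ of the discrete scheme satisfies: (i) $\underline u\le u_h^k\le \overline u$ on $[0,\ell]$ for all $k\ge 0$ with $0\le t^k\le T$; (ii) $\displaystyle\sum_{k\ge 1,\ t^k\le T}\tau\,\mathcal D(u_h^k)\le C$ and $\displaystyle\sum_{k\ge 1,\ t^k\le T}\tau\,\|d_\tau u_h^k\|_{L^2(0,\ell)}^2\le C$; (iii) $\displaystyle\int_0^\ell M(\partial_x u_h^k)\,dx\le C$ for all $k\ge 0$ with $0\le t^k\le T$.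
   Context: Standing assumptions. $\ell>0$; $\alpha>0$ is a constant and $0<T<\infty$. $\beta\in C^0(\mathbb R)$ is $C^1$ on $\mathbb R\setminus\{0\}$ with $\beta'>0$ there, and $B(u):=\int_0^u\beta(s)\,ds$ is coercive. $\mu\in C^0(\mathbb R)$ with $\mu(0)=0$ is $C^1$ on $\mathbb R\setminus\{0\}$ with $\mu'>0$ there; $M(s):=\int_0^s\mu(\tilde s)\,d\tilde s$. $u_0\in L^\infty(0,\ell)$ is weakly differentiable with $M(\partial_x u_0)\in L^1(0,\ell)$ (hence $u_0$ is continuous on $[0,\ell]$). $u_\partial\in W^{1,\infty}((0,\infty)\times\{0,\ell\})$, i.e. $u_\partial$ is a bounded Lipschitz function of time at each of the two endpoints. There are constants $\underline u,\overline u>0$ with $0<\underline u\le u_0\le\overline u$ and $\underline u\le u_\partial\le\overline u$ uniformly in $x$ and $t$. Discretization. $\langle f,g\rangle=\int_0^\ell fg\,dx$ and $\langle f,g\rangle_\partial=f(0)g(0)+f(\ell)g(\ell)$. For $h=\ell/N$ let $x_i=ih$, $0\le i\le N$, and let $V_h$ be the space of continuous functions on $[0,\ell]$ that are affine on each $[x_{i-1},x_i]$. $I_h$ is the nodal interpolation operator into $V_h$ and $\langle a,b\rangle_h=\int_0^\ell I_h(ab)\,dx$. For $\tau>0$: $t^k=k\tau$ and $d_\tau u^k=\frac1\tau(u^k-u^{k-1})$. Discrete scheme: $u_h^0=I_hu_0$, and for $k\ge1$, $u_h^k\in V_h$ satisfies $$\langle d_\tau\beta(u_h^k),v_h\rangle_h+\langle\mu(\partial_xu_h^k),\partial_xv_h\rangle+\alpha\langle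 u_h^k,v_h\rangle_\partial=\alpha\langle u_\partial(t^k),v_h\rangle_\partial\qquad\forall v_h\in V_h,$$ where $d_\tau\beta(u_h^k)=\frac1\tau(\beta(u_h^k)-\beta(u_h^{k-1}))$. This scheme has a unique solution. Dissipation functional: $\mathcal D(u)=\int_0^\ell\mu(\partial_xu)\,\partial_xu\,dx+\alpha\langle u,u\rangle_\partial$. *)

(* Defs.v *)
From HB Require Import structures.
From mathcomp Require Import all_boot all_order all_algebra.
From mathcomp Require Import all_classical all_reals all_analysis.
From mathcomp Require Import ring lra.

Set Implicit Arguments.
Unset Strict Implicit.
Unset Printing Implicit Defensive.

Import Order.TTheory GRing.Theory Num.Theory.
Import numFieldNormedType.Exports.

Local Open Scope ring_scope.
Local Open Scope classical_set_scope.

Notation leb := (@lebesgue_measure _).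

Section Data.
Context {R : realType}.
Implicit Types (f u g phi : R -> R) (l : R).

(* u |-> \int_0^u f(s) ds, with the usual sign convention for u < 0 *)
Definition primitive0 f (u : R) : R :=
  if 0 <= u then \int[leb]_(s in `[0, u]) f s
  else - \int[leb]_(s in `[u, 0]) f s.

Definition C1_increasing_away0 f : Prop :=
  continuous f /\
  forall x, x != 0 ->
    [/\ derivable f x 1, {for x, continuous (derive1 f)} & 0 < derive1 f x].

Definition coercive f : Prop :=
  f x @[x --> +oo] --> +oo /\ f x @[x --> -oo] --> +oo.

Definition test_function (a b : R) phi : Prop :=
  [/\ forall n x, derivable (derive1n n phi) x 1,
      compact (closure [set x | phi x != 0]) &
      closure [set x | phi x != 0] `<=` `]a, b[].

Definition weak_derivative (a b : R) u g : Prop :=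
  [/\ locally_integrable `]a, b[ u,
      locally_integrable `]a, b[ g &
      forall phi, test_function a b phi ->
        \int[leb]_(x in `]a, b[) (u x * derive1 phi x) =
        - \int[leb]_(x in `]a, b[) (g x * phi x)].

Definition essentially_bounded (a b : R) u : Prop :=
  measurable_fun `]a, b[ u /\
  exists K : R, {ae leb, forall x, `]a, b[ x -> `|u x| <= K}.

(* u is the continuous representative of its almost-everywhere class. *)
Definition initial_datum (l : R) (mu u : R -> R) : Prop :=
  [/\ essentially_bounded 0 l u,
      {within `[0, l], continuous u} &
      exists2 g, weak_derivative 0 l u g &
        leb.-integrable `]0, l[ (EFin \o (primitive0 mu \o g))].

(* ud t x is the value of the boundary datum at time t and end point x. *)
Definition boundary_datum (l : R) (ud : R -> R -> R) : Prop :=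
  forall x, x = 0 \/ x = l ->
    (exists K : R, forall t, 0 < t -> `|ud t x| <= K) /\
    [lipschitz ud t x | t in `]0, +oo[].

End Data.

Section Scheme.
Context {R : realType}.
Implicit Types (f g u v : R -> R) (l tau alpha : R) (N : nat).

Definition ip l f g : R := \int[leb]_(x in `[0, l]) (f x * g x).
Definition bdry l f g : R := f 0 * g 0 + f l * g l.

Definition mesh l N : R := l / N%:R.
Definition node l N (i : nat) : R := i%:R * mesh l N.

(* Functions on [0, l] are represented by total functions on R; their values
   outside [0, l] are unconstrained and never used.  The derivative of
   an element v of this space is thus meaningful off the nodes only, that is
   almost everywhere on [0, l], and occurs only under an integral. *)
Definition Vh l N v : Prop :=
  {within `[0, l], continuous v} /\
  forall i, (i < N)%N -> exists a b : R,
    forall x, node l N i <= x <= node l N i.+1 -> v x = a * x + b.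

Definition hat l N (i : nat) (x : R) : R :=
  Num.max 0 (1 - `|x - node l N i| / mesh l N).

Definition Ih l N f : R -> R :=
  fun x => \sum_(i < N.+1) f (node l N i) * hat l N i x.

Definition ip_h l N f g : R :=
  \int[leb]_(x in `[0, l]) Ih l N (fun y => f y * g y) x.

Definition time tau (k : nat) : R := k%:R * tau.

Definition dtau tau (w : nat -> R -> R) (k : nat) : R -> R :=
  fun x => tau^-1 * (w k x - w k.-1 x).

Definition discrete_solution l alpha (beta mu u0 : R -> R) (ud : R -> R -> R)
    N tau (u : nat -> R -> R) : Prop :=
  (forall x, 0 <= x <= l -> u 0%N x = Ih l N u0 x) /\
  forall k, (0 < k)%N -> Vh l N (u k) /\
    forall v, Vh l N v ->
      ip_h l N (dtau tau (fun j => beta \o u j) k) v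
      + ip l (mu \o derive1 (u k)) (derive1 v)
      + alpha * bdry l (u k) v
      = alpha * bdry l (ud (time tau k)) v.

Definition dissipation l alpha (mu : R -> R) u : R :=
  ip l (mu \o derive1 u) (derive1 u) + alpha * bdry l u u.

Definition L2norm_sq l f : R := ip l f f.

(* The largest k with time tau k <= T, provided tau > 0 and T >= 0. *)
Definition last_step (T tau : R) : nat := Num.truncn (T / tau).

Lemma last_stepP (T tau : R) (k : nat) : 0 < tau -> 0 <= T ->
  (k <= last_step T tau)%N = (time tau k <= T).
Proof.
move=> tau0 T0; rewrite /last_step /time -ler_pdivlMr//.
by rewrite truncn_ge_nat// divr_ge0// ltW.
Qed.

Lemma hat_node l N (i j : nat) : 0 < l -> (0 < N)%N ->
  hat l N i (node l N j) = (i == j)%:R.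
Proof.
move=> l0 N0; have h0 : 0 < mesh l N by rewrite divr_gt0// ltr0n.
rewrite /hat /node -mulrBl normrM (gtr0_norm h0) mulfK ?lt0r_neq0//.
have [->|ij] := eqVneq i j; first by rewrite subrr normr0 subr0 max_r ?ler01//.
apply/max_l; rewrite subr_le0; move: ij; rewrite neq_ltn => /orP[] ij.
  by rewrite -natrB ?(ltnW ij)// normr_nat ler1n subn_gt0.
by rewrite distrC -natrB ?(ltnW ij)// normr_nat ler1n subn_gt0.
Qed.

Lemma Ih_node l N f (j : nat) : 0 < l -> (0 < N)%N -> (j <= N)%N ->
  Ih l N f (node l N j) = f (node l N j).
Proof.
move=> l0 N0 jN; rewrite /Ih (bigD1 (Ordinal (jN : (j < N.+1)%N)))//= big1.
  by rewrite hat_node// eqxx mulr1 addr0.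
move=> i; rewrite -val_eqE/= => ij.
by rewrite hat_node// (negbTE ij) mulr0.
Qed.

Lemma continuous_hat l N i : continuous (hat l N i : R -> R).
Proof.
move=> x; pose g y : R := 1 - `|y - node l N i| / mesh l N.
have gc : {for x, continuous (g : R -> R^o)}.
  apply: cvgB; first exact: cvg_cst.
  by apply: cvgMr_tmp; apply: cvg_norm; apply: cvgB;
    [exact: cvg_id|exact: cvg_cst].
exact: (@continuous_max R R (cst 0) g x (@cst_continuous _ _ _ _) gc).
Qed.

Lemma hat_affine l N (i j : nat) : 0 < l -> (0 < N)%N ->
  exists ab : R * R, forall x, node l N j <= x <= node l N j.+1 ->
    hat l N i x = ab.1 * x + ab.2.
Proof.
move=> l0 N0; have h0 : 0 < mesh l N by rewrite divr_gt0// ltr0n.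
have far x : mesh l N <= `|x - node l N i| -> hat l N i x = 0.
  by move=> ?; apply/max_l; rewrite subr_le0 ler_pdivlMr// mul1r.
have near x : `|x - node l N i| <= mesh l N ->
    hat l N i x = 1 - `|x - node l N i| / mesh l N.
  by move=> ?; apply/max_r; rewrite subr_ge0 ler_pdivrMr// mul1r.
have nodeS k : node l N k.+1 = node l N k + mesh l N.
  by rewrite /node -natr1 mulrDl mul1r.
have node_le k m : (k <= m)%N -> node l N k <= node l N m.
  by move=> km; rewrite ler_pM2r// ler_nat.
have [ij|ij|<-] := ltngtP i j.
- exists (0, 0) => x; rewrite mul0r addr0 => /andP[xj _].
  apply: far; rewrite ler_normr; apply/orP; left.
  by have := node_le _ _ ij; rewrite nodeS; lra.
- have [ij1|ij1] := eqVneq i j.+1.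
    exists ((mesh l N)^-1, 1 - node l N i / mesh l N) => x /andP[].
    rewrite -ij1 => xj xi; have := nodeS j; rewrite -ij1 => jS.
    rewrite near; last by rewrite ler0_norm; lra.
    by rewrite ler0_norm /=; [field; rewrite gt_eqF|lra].
  exists (0, 0) => x; rewrite mul0r addr0 => /andP[_ xj].
  apply: far; rewrite ler_normr; apply/orP; right.
  have {}ij : (j.+2 <= i)%N by rewrite ltn_neqAle eq_sym ij1.
  by have := node_le _ _ ij; rewrite (nodeS j.+1); lra.
exists (- (mesh l N)^-1, 1 + node l N i / mesh l N) => x /andP[].
rewrite nodeS => xj xj1; rewrite near; last by rewrite ger0_norm; lra.
by rewrite ger0_norm /=; [field; rewrite gt_eqF|lra].
Qed.

Lemma Vh_Ih l N f : 0 < l -> (0 < N)%N -> Vh l N (Ih l N f).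
Proof.
move=> l0 N0; split.
  apply: continuous_subspaceT => x; rewrite /Ih; apply: cvg_big => [|i _].
    exact: add_continuous.
  by apply: cvgMl_tmp; exact: continuous_hat.
move=> j _; have /choice[ab abP] := fun i : nat => hat_affine i j l0 N0.
exists (\sum_(i < N.+1) f (node l N i) * (ab i).1),
       (\sum_(i < N.+1) f (node l N i) * (ab i).2) => x xj.
rewrite /Ih mulr_suml -big_split/=; apply: eq_bigr => i _.
by rewrite (abP i x xj) mulrDr mulrA.
Qed.

End Scheme.

(* Main.v *)
(** Testing the scheme with nodal values turns it into sums over the nodes, with
    weights given by the integrals of the hat functions, and over the elements,
    on which the slope is constant.  The test function (u^k - umax)^+ and its
    mirror image give the bounds (i), first at the end points and then from node
    to node by the sign of mu.  Testing with u^k bounds the dissipation: the time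
    term telescopes against the convex conjugate of the antiderivative of beta.
    Testing with d_tau u^k makes the gradient term telescope against the energy
    M(d_x u), by convexity of M; beta' is bounded below on [umin, umax], and the
    boundary datum is summed by parts in time.

    The energy of I_h u0 is at most that of u0 by Jensen's inequality on each
    element, provided u0(b) - u0(a) is the integral of the weak derivative over
    [a, b].  This is obtained from test functions which are differences of two
    translates of a smooth step, built from exp(-1/x). *)
Require Import Defs.
From HB Require Import structures.
From mathcomp Require Import all_boot all_order all_algebra.
From mathcomp Require Import all_classical all_reals all_analysis.
From mathcomp Require Import measurable_realfun.
From mathcomp Require Import ring lra.
Import Order.TTheory GRing.Theory Num.Theory.
Import numFieldNormedType.Exports.
Local Open Scope ring_scope.
Local Open Scope classical_set_scope.

Set Implicit Arguments.
Unset Strict Implicit.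
Unset Printing Implicit Defensive.

(** * A smooth step *)

Section SmoothStep.
Context {R : realType}.
Implicit Types (f g : R -> R) (p q : {poly R}).

Definition smooth f := forall n (x : R), derivable (derive1n n f) x 1.

(* Each member has a derivative in the class, so all members are smooth. *)
Inductive smooth_closure : (R -> R) -> Prop :=
| SmoothBase f : smooth f -> smooth_closure f
| SmoothCst c : smooth_closure (cst c)
| SmoothAdd f g : smooth_closure f -> smooth_closure g ->
    smooth_closure (fun x => f x + g x)
| SmoothMul f g : smooth_closure f -> smooth_closure g ->
    smooth_closure (fun x => f x * g x)
| SmoothInv f : smooth_closure f -> (forall x, f x != 0) ->
    smooth_closure (fun x => (f x)^-1)
| SmoothAffine f a b : smooth_closure f -> smooth_closure (fun x => f (a * x + b)).

Lemma is_derive_derive1 f : (forall x : R, derivable f x 1) ->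
  forall x : R, is_derive x 1 f (derive1 f x).
Proof. by move=> df x; apply: DeriveDef => //; rewrite derive1E. Qed.

Lemma derive1_is_derive f (df : R -> R) : (forall x : R, is_derive x 1 f (df x)) ->
  derive1 f = df.
Proof. by move=> fE; apply/funext => x; rewrite derive1E derive_val. Qed.

Lemma smooth_closure_derive f : smooth_closure f ->
  exists2 df : R -> R, forall x : R, is_derive x 1 f (df x) & smooth_closure df.
Proof.
elim=> {f} [f sf|c|f g _ [df dfE sdf] _ [dg dgE sdg]
  |f g sf [df dfE sdf] sg [dg dgE sdg]|f sf [df dfE sdf] f0|f a b _ [df dfE sdf]].
- exists (derive1 f); first exact/is_derive_derive1/(sf 0%N).
  by apply: SmoothBase => n x; rewrite -derive1Sn; exact: sf.
- exists (cst 0); last exact: SmoothCst.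
  by move=> x; exact: is_derive_cst.
- exists (fun x => df x + dg x); last exact: SmoothAdd.
  by move=> x; exact: is_deriveD.
- exists (fun x => f x * dg x + g x * df x).
    by move=> x; exact: is_deriveM.
  by apply: SmoothAdd; exact: SmoothMul.
- exists (fun x => (-1) * ((f x)^-1 * (f x)^-1) * df x).
    move=> x; have := is_deriveV (f0 x) (dfE x).
    by rewrite /GRing.scale/= expr2 invfM mulN1r.
  apply: SmoothMul => //; apply: (SmoothMul (f := cst (-1))); first exact: SmoothCst.
  by apply: SmoothMul; exact: SmoothInv.
- exists (fun x => df (a * x + b) * a).
    move=> x; apply: (@is_derive1_comp _ f (fun x => a * x + b)).
    have -> : (fun x0 => a * x0 + b) = (a *: id + cst b) by exact/funext.
    by apply: is_derive_eq; rewrite addr0 /GRing.scale/= mulr1.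
  apply: (SmoothMul (g := cst a)); last exact: SmoothCst.
  exact: SmoothAffine.
Qed.

Lemma smooth_closureP f : smooth_closure f -> smooth f.
Proof.
move=> sf n; elim: n => [|n IH] in f sf *.
  by have [df dfE _] := smooth_closure_derive sf; move=> x; exact: ex_derive.
have [df /derive1_is_derive dfE sdf] := smooth_closure_derive sf.
by move=> x; rewrite derive1Sn dfE; exact: IH.
Qed.

(** The polynomial in 1/x in front of exp(-1/x) makes this family closed under differentiation. *)
Definition flat p (x : R) : R := if 0 < x then p.[x^-1] * expR (- x^-1) else 0.

(** Splitting off a factor x serves twice at the origin: it gives continuity there, and
    [flat (p * 'X)] is the difference quotient there. *)
Lemma flat_shift p x : flat p x = flat (p * 'X) x * x.
Proof.
rewrite /flat; case: ifPn => [x0|_]; last by rewrite mul0r.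
by rewrite hornerMX; field; rewrite gt_eqF.
Qed.

Lemma exprn_le_expR (y : R) i : 0 <= y -> y ^+ i <= i`!%:R * expR y.
Proof.
move=> y0; case: i => [|i].
  by rewrite expr0 fact0 mul1r; have := expR_ge1Dx y; lra.
have := expR_ge1Dxn i y0; rewrite -ler_pdivrMl ?ltr0n ?fact_gt0// mulrC.
lra.
Qed.

(** With y = 1/x, each term |p_i| y^i is at most |p_i| i! exp(y), and the factor exp(-y) cancels the
    exponential. *)
Lemma flat_bounded p : exists C, forall x, `|flat p x| <= C.
Proof.
exists (\sum_(i < size p) `|p`_i| * i`!%:R) => x; rewrite /flat.
case: ifPn => [x0|_]; last by rewrite normr0 sumr_ge0// => i _; rewrite mulr_ge0.
rewrite normrM (gtr0_norm (expR_gt0 _)) expRN ler_pdivrMr ?expR_gt0//.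
rewrite horner_coef (le_trans (ler_norm_sum _ _ _))// mulr_suml ler_sum// => i _.
rewrite normrM -mulrA ler_wpM2l// ger0_norm ?exprn_ge0 ?invr_ge0 ?(ltW x0)//.
by apply: exprn_le_expR; rewrite invr_ge0 ltW.
Qed.

Lemma flat_cvg0 p : {for 0, continuous (flat p)}.
Proof.
have [C Cp] := flat_bounded (p * 'X).
have C0 : 0 <= C by apply: le_trans (Cp 0).
have f0 : flat p 0 = 0 by rewrite /flat ltxx.
apply/cvgrPdist_le => /= e e0.
near=> x; rewrite f0 sub0r normrN flat_shift normrM.
rewrite (@le_trans _ _ (C * `|x|))// ?ler_wpM2r//.
(* Dividing by C + 1 covers the case C = 0. *)
have : `|x| <= e / (C + 1).
  near: x; have d0 : 0 < e / (C + 1) by rewrite divr_gt0//; lra.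
  by near=> x; rewrite -[x]subr0 distrC; near: x; exact: cvgr_dist_le d0.
by rewrite ler_pdivlMr; have := normr_ge0 x; nra.
Unshelve. all: by end_near. Qed.

(** The derivative of p(1/x) exp(-1/x) is x^-2 (p - p')(1/x) exp(-1/x); this is the polynomial in
    1/x that occurs in it. *)
Definition dflat p : {poly R} := 'X^2 * (p - p^`()).

Lemma flat_is_derive p (x : R) : is_derive x 1 (flat p) (flat (dflat p) x).
Proof.
have [x0|x0|->] := ltgtP x 0.
- have -> : flat (dflat p) x = 0 by rewrite /flat ltNge ltW.
  apply: (@near_eq_is_derive _ _ _ (cst 0)).
  by near=> y; rewrite /flat ltNge ltW//; near: y; exact: lt_nbhsl.
- have dV : is_derive x 1 (fun y : R => y^-1) (- x ^- 2).
    have := @is_deriveV _ id _ _ _ (lt0r_neq0 x0) (is_derive_id x 1).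
    by rewrite /GRing.scale/= mulr1.
  have dp := is_derive1_comp (is_derive_poly p x^-1) dV.
  have dN := is_derive1_comp (is_deriveNid x^-1 1) dV.
  have de := @is_derive1_comp _ expR (-%R \o GRing.inv) x _ _
    (is_derive_expR (- x^-1)) dN.
  have dM := is_deriveM dp de.
  have -> : flat (dflat p) x =
      p.[x^-1] *: (expR (- x^-1) * (- 1 * - x ^- 2)) +
      expR (- x^-1) *: (p^`().[x^-1] * - x ^- 2).
    rewrite /flat x0 /dflat /GRing.scale/= hornerM hornerXn hornerD hornerN -exprVn.
    ring.
  apply: near_eq_is_derive dM.
  by near=> y; rewrite /flat ifT//=; near: y; exact: lt_nbhsr.
- have f0 q : flat q 0 = 0 by rewrite /flat ltxx.
  (* By Caratheodory's criterion it suffices that the difference quotient at 0 is continuous there,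
     with value 0. *)
  rewrite f0; apply/is_derive1_caratheodory.
  exists (flat (p * 'X)); split; last exact: f0.
    by move=> z; rewrite f0 !subr0; exact: flat_shift.
  exact: flat_cvg0.
Unshelve. all: by end_near. Qed.

Lemma smooth_flat p : smooth (flat p).
Proof.
move=> n; elim: n => [|n IH] in p *.
  by move=> x; have := flat_is_derive p x => ?; exact: ex_derive.
by move=> x; rewrite derive1Sn (derive1_is_derive (flat_is_derive p)); exact: IH.
Qed.

Lemma flat1_gt0 (x : R) : (0 < flat 1 x) = (0 < x).
Proof.
by rewrite /flat; case: ifPn => [x0|_]; rewrite ?ltxx// hornerC mul1r expR_gt0.
Qed.

Lemma flat1_ge0 (x : R) : 0 <= flat 1 x.
Proof. by rewrite /flat; case: ifPn => // _; rewrite hornerC mul1r expR_ge0. Qed.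

Lemma flat1_eq0 (x : R) : x <= 0 -> flat 1 x = 0.
Proof. by rewrite /flat ltNge => ->. Qed.

Lemma flat_d1_ge0 (x : R) : 0 <= flat (dflat 1) x.
Proof.
rewrite /flat; case: ifPn => // x0.
rewrite /dflat derivC subr0 mulr1 hornerXn mulr_ge0// ?expR_ge0//.
exact: sqr_ge0.
Qed.

(** The numbers x and 1 - x are not both nonpositive, and [flat 1] is positive on positive
    arguments. *)
Lemma flat_sum_neq0 (x : R) : flat 1 x + flat 1 (1 - x) != 0.
Proof.
rewrite gt_eqF//; have [x0|x0] := ltP 0 x.
  by rewrite ltr_wpDr ?flat1_ge0// flat1_gt0.
by rewrite ltr_wpDl ?flat1_ge0// flat1_gt0; lra.
Qed.

Definition step (x : R) : R := flat 1 x * (flat 1 x + flat 1 (1 - x))^-1.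

Lemma smooth_step : smooth step.
Proof.
apply: smooth_closureP.
have s1 : smooth_closure (flat 1) by apply: SmoothBase; exact: smooth_flat.
have s2 : smooth_closure (fun x => flat 1 (1 - x)).
  have -> : (fun x : R => flat 1 (1 - x)) = (fun x => flat 1 ((-1) * x + 1)).
    by apply/funext => x; congr flat; ring.
  exact: SmoothAffine.
apply: SmoothMul => //; apply: SmoothInv; last exact: flat_sum_neq0.
exact: SmoothAdd.
Qed.

Lemma step_eq0 x : x <= 0 -> step x = 0.
Proof. by move=> x0; rewrite /step flat1_eq0// mul0r. Qed.

Lemma step_eq1 x : 1 <= x -> step x = 1.
Proof.
move=> x1; rewrite /step (flat1_eq0 (_ : 1 - x <= 0)) ?addr0 ?subr_le0//.
by rewrite divff// gt_eqF// flat1_gt0; lra.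
Qed.

Lemma step_itv x : 0 <= step x <= 1.
Proof.
have f1 := flat1_ge0 x; have f2 := flat1_ge0 (1 - x).
have d0 : 0 < flat 1 x + flat 1 (1 - x).
  by rewrite lt_neqAle eq_sym flat_sum_neq0 addr_ge0.
by rewrite /step divr_ge0 ?(ltW d0)//= ler_pdivrMr// mul1r lerDl.
Qed.

Lemma derive1_step_ge0 x : 0 <= derive1 step x.
Proof.
have dx := flat_is_derive 1 x.
have d2 : is_derive x 1 (fun y : R => flat 1 (1 - y)) (- flat (dflat 1) (1 - x)).
  have dg : is_derive x 1 (fun y : R => 1 - y) (-1).
    by have := is_deriveB (is_derive_cst (1 : R) x 1) (is_derive_id x 1); rewrite sub0r.
  have := @is_derive1_comp _ _ (fun y => 1 - y) x _ _ (flat_is_derive 1 (1 - x)) dg.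
  by rewrite mulrN1.
have ds := is_deriveD dx d2.
have dV := @is_deriveV _ (fun y => flat 1 y + flat 1 (1 - y)) x _ _ (flat_sum_neq0 x) ds.
have dq : is_derive x 1 step _ := is_deriveM dx dV.
rewrite derive1E (@derive_val _ _ _ _ _ _ _ dq) /GRing.scale/=.
have f1 := flat1_ge0 x; have f2 := flat1_ge0 (1 - x).
have g1 := flat_d1_ge0 x; have g2 := flat_d1_ge0 (1 - x).
have d0 := flat_sum_neq0 x.
set a := flat 1 x in f1 d0 *; set b := flat 1 (1 - x) in f2 d0 *.
set a' := flat _ x in g1 *; set b' := flat _ (1 - x) in g2 *.
(* The reflection in the second summand gives its derivative the sign of -b', so the quotient rule
   leaves a numerator with nonnegative terms only. *)
have -> : a * (- (a + b) ^- 2 * (a' - b')) + (a + b)^-1 * a' =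
  (a * b' + b * a') * (a + b) ^- 2 by field.
by rewrite mulr_ge0 ?addr_ge0 ?mulr_ge0// invr_ge0 sqr_ge0.
Qed.

End SmoothStep.

(** * The fundamental theorem for weak derivatives *)

Section WeakFTC.
Context {R : realType}.
Implicit Types (f g u : R -> R) (a b c d k x : R).

Lemma integrable_itv_cc a b f : leb.-integrable `]a, b[ (EFin \o f) ->
  leb.-integrable `[a, b] (EFin \o f).
Proof.
move=> /integrableP[mf fi]; apply/integrableP.
have mf' := (emeasurable_fun_itv_obnd_cbndP _ _ _).1 mf.
split; first exact/emeasurable_fun_itv_bndo_bndcP.
rewrite -integral_itv_bndo_bndc; last exact: measurableT_comp.
by rewrite -integral_itv_obnd_cbnd//; exact: measurableT_comp.
Qed.

Lemma integrable_continuous a b f : {within `[a, b], continuous f} ->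
  leb.-integrable `[a, b] (EFin \o f).
Proof.
by move=> cf; apply: continuous_compact_integrable => //; exact: segment_compact.
Qed.

Lemma integrable_oo a b f : leb.-integrable `[a, b] (EFin \o f) ->
  leb.-integrable `]a, b[ (EFin \o f).
Proof. by apply: integrableS => //; exact: subset_itv_oo_cc. Qed.

Lemma Rintegral_cc_oo a b f : leb.-integrable `[a, b] (EFin \o f) ->
  \int[leb]_(x in `[a, b]) f x = \int[leb]_(x in `]a, b[) f x.
Proof.
move=> fi; rewrite -Rintegral_itv_bndo_bndc.
  by rewrite -Rintegral_itv_obnd_cbnd//; exact: integrable_oo.
by apply: integrableS fi => //; apply: subset_itvl; rewrite bnd_simp.
Qed.

Lemma Rintegral_is_derive a b f (df : R -> R) : a <= b ->
  (forall x, is_derive x 1 f (df x)) -> {within `[a, b], continuous df} ->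
  \int[leb]_(x in `[a, b]) df x = f b - f a.
Proof.
rewrite le_eqVlt => /predU1P[<- _ _|ab dfE dfc].
  by rewrite set_itv1 Rintegral_set1 subrr.
have fc x : {for x, continuous f}.
  apply/differentiable_continuous/derivable1_diffP.
  by have := dfE x => ?; exact: ex_derive.
rewrite /Rintegral (continuous_FTC2 (F := f) ab dfc)//.
  split=> [x _| |].
  - by have := dfE x => ?; exact: ex_derive.
  - by apply: cvg_at_right_filter; exact: fc.
  - by apply: cvg_at_left_filter; exact: fc.
by move=> x _; rewrite (derive1_is_derive dfE).
Qed.

(** The transition is compressed to [a, a + 1/k]: for large k the ramp approximates the indicator of
    the points to the right of a, and its derivative a unit mass at a. *)
Definition ramp a k x : R := step (k * x - k * a).

Lemma ramp_is_derive a k x : is_derive x 1 (ramp a k) (k * derive1 step (k * x - k * a)).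
Proof.
have ds := is_derive_derive1 (@smooth_step R 0%N) (k * x - k * a).
have dg : is_derive x 1 (fun y => k * y - k * a) k.
  have := is_deriveB (is_deriveZ k (is_derive_id x 1)) (is_derive_cst (k * a) x 1).
  by rewrite subr0 /GRing.scale/= mulr1.
by rewrite mulrC; exact: (@is_derive1_comp _ step (fun y => k * y - k * a)).
Qed.

Lemma derive1_ramp a k : derive1 (ramp a k) = fun x => k * derive1 step (k * x - k * a).
Proof. exact: derive1_is_derive (ramp_is_derive a k). Qed.

Lemma smooth_ramp a k : smooth_closure (ramp a k).
Proof. by apply: (SmoothAffine k (- (k * a))); apply: SmoothBase; exact: smooth_step. Qed.

Lemma continuous_smooth f : smooth f -> continuous f.
Proof.
move=> sf x; apply/differentiable_continuous/derivable1_diffP; exact: (sf 0%N).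
Qed.

Lemma continuous_ramp a k : continuous (ramp a k).
Proof. exact/continuous_smooth/smooth_closureP/smooth_ramp. Qed.

Lemma continuous_derive1_ramp a k : continuous (derive1 (ramp a k)).
Proof.
apply: continuous_smooth => n x; rewrite -derive1Sn.
exact: (smooth_closureP (smooth_ramp a k)).
Qed.

Lemma ramp_eq0 a k x : 0 < k -> x <= a -> ramp a k x = 0.
Proof. by move=> k0 xa; rewrite /ramp step_eq0// -mulrBr pmulr_rle0// subr_le0. Qed.

Lemma ramp_eq1 a k x : 0 < k -> a + k^-1 <= x -> ramp a k x = 1.
Proof.
move=> k0 xa; rewrite /ramp step_eq1// -mulrBr -ler_pdivrMl// mulr1; lra.
Qed.

Lemma ramp_itv a k x : 0 <= ramp a k x <= 1.
Proof. exact: step_itv. Qed.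

Lemma derive1_ramp_ge0 a k x : 0 < k -> 0 <= derive1 (ramp a k) x.
Proof. by move=> k0; rewrite derive1_ramp mulr_ge0 ?derive1_step_ge0// ltW. Qed.

(** Off the transition interval the ramp is locally constant. *)
Lemma derive1_ramp_eq0 a k x : 0 < k -> x < a \/ a + k^-1 < x ->
  derive1 (ramp a k) x = 0.
Proof.
move=> k0 xa; suff [c xc] : exists c, \near x, cst c x = ramp a k x.
  by rewrite derive1E -(near_eq_derive _ xc) derive_cst.
case: xa => xa.
  exists 0; near=> y; rewrite ramp_eq0// ltW//.
  by near: y; exact: lt_nbhsl.
exists 1; near=> y; rewrite ramp_eq1// ltW//.
by near: y; exact: lt_nbhsr.
Unshelve. all: by end_near. Qed.

Lemma Rintegral_derive1_ramp c d a k : 0 < k -> c <= a -> a + k^-1 <= d ->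
  \int[leb]_(x in `]c, d[) derive1 (ramp a k) x = 1.
Proof.
move=> k0 ca ad; have k'0 : 0 < k^-1 by rewrite invr_gt0.
have rc : {within `[c, d], continuous (derive1 (ramp a k))}.
  by apply: continuous_subspaceT; exact: continuous_derive1_ramp.
rewrite -Rintegral_cc_oo; last exact: integrable_continuous.
have dr x : is_derive x 1 (ramp a k) (derive1 (ramp a k) x).
  by rewrite derive1_ramp; exact: ramp_is_derive.
have cd : c <= d by lra.
by rewrite (Rintegral_is_derive cd dr rc) ramp_eq1// ramp_eq0// subr0.
Qed.

Lemma continuous_within_mul (A : set R) f g : {within A, continuous f} ->
  continuous g -> {within A, continuous (fun x => f x * g x)}.
Proof.
move=> fc gc x; apply: cvgM; first exact: fc.
exact: (continuous_subspaceT gc).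
Qed.

(** The derivative of the ramp is a nonnegative weight of integral 1 carried by [a, a + 1/k], so the
    integral is a weighted mean of u over that interval. *)
Lemma ramp_mean_value c d a k u e : 0 < k -> c <= a -> a + k^-1 <= d ->
  {within `[c, d], continuous u} ->
  (forall x, a <= x <= a + k^-1 -> `|u x - u a| <= e) ->
  `|\int[leb]_(x in `]c, d[) (u x * derive1 (ramp a k) x) - u a| <= e.
Proof.
move=> k0 ca ad uc ue.
have rc : {within `[c, d], continuous (derive1 (ramp a k))}.
  by apply: continuous_subspaceT; exact: continuous_derive1_ramp.
have ri := integrable_oo (integrable_continuous rc).
have uri := integrable_oo (integrable_continuous
  (continuous_within_mul uc (continuous_derive1_ramp (k := k) (a := a)))).
have ci (z : R) : leb.-integrable `]c, d[ (EFin \o (fun x => z * derive1 (ramp a k) x)).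
  by apply: (integrableZl _ z ri).
have I (z : R) : \int[leb]_(x in `]c, d[) (z * derive1 (ramp a k) x) = z.
  by rewrite RintegralZl// Rintegral_derive1_ramp// mulr1.
have bnd x : `]c, d[%classic x ->
    (u a - e) * derive1 (ramp a k) x <= u x * derive1 (ramp a k) x
    <= (u a + e) * derive1 (ramp a k) x.
  move=> _; have [xa|ax] := ltP x a.
    by rewrite derive1_ramp_eq0 ?mulr0 ?lexx//; left.
  have [ax'|xa'] := ltP (a + k^-1) x.
    by rewrite derive1_ramp_eq0 ?mulr0 ?lexx//; right.
  have := ue x; rewrite ax xa' => /(_ isT); rewrite ler_norml => /andP[e1 e2].
  by apply/andP; split; apply: ler_wpM2r; rewrite ?derive1_ramp_ge0//; lra.
rewrite ler_norml; apply/andP; split.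
  rewrite lerBrDr addrC -[leLHS]I; apply: le_Rintegral => // x /bnd/andP[]//.
rewrite lerBlDr addrC -[leRHS]I; apply: le_Rintegral => // x /bnd/andP[]//.
Qed.

Lemma ramp_mean_cvg c d a u : c < a < d -> {within `[c, d], continuous u} ->
  \int[leb]_(x in `]c, d[) (u x * derive1 (ramp a n.+1%:R) x) @[n --> \oo] --> u a.
Proof.
move=> /andP[ca ad] uc; apply/cvgrPdist_le => /= e e0.
have ua : {for a, continuous u}.
  by apply: (within_continuous_continuous (lt_trans ca ad) uc); rewrite in_itv/= ca.
have /cvgrPdist_le/(_ _ e0)/nbhs_ballP[r /= r0 ur] := ua.
(* A transition width below r keeps u within e of [u a]; a width below d - a keeps the transition
   inside ]c, d[. *)
have r'0 : 0 < Num.min r (d - a) by rewrite lt_min r0 subr_gt0.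
near=> n; rewrite distrC.
have nr : n.+1%:R^-1 < Num.min r (d - a).
  by near: n; exact: (near_infty_natSinv_lt (PosNum r'0)).
move: nr; rewrite lt_min => /andP[nr nd].
apply: ramp_mean_value => //; [exact: ltW|by rewrite -lerBrDl ltW|].
move=> x /andP[ax xa].
rewrite distrC; apply: ur; rewrite /ball/= distrC ger0_norm ?subr_ge0//.
by apply: le_lt_trans nr; rewrite lerBlDl.
Unshelve. all: by end_near. Qed.

Lemma test_function_ramp c d a b k : 0 < k -> c < a -> a <= b -> b + k^-1 < d ->
  test_function c d (fun x => ramp a k x - ramp b k x).
Proof.
move=> k0 ca ab bd; have k'0 : 0 < k^-1 by rewrite invr_gt0.
(* To the left of a both ramps are 0 and to the right of b + 1/k both are 1, so they cancel. *)
have sub : closure [set x | ramp a k x - ramp b k x != 0] `<=` `[a, b + k^-1].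
  rewrite [X in _ `<=` X](closure_id _).1; last exact: itv_closed.
  apply: closureS => x /=; rewrite in_itv/=; apply: contraR.
  rewrite negb_and -!ltNge => /orP[xa|bx].
    by rewrite !ramp_eq0 ?subrr//; lra.
  by rewrite !ramp_eq1 ?subrr//; lra.
split.
- apply: smooth_closureP.
  have -> : (fun x => ramp a k x - ramp b k x) =
      (fun x => ramp a k x + cst (-1) x * ramp b k x).
    by apply/funext => x; rewrite mulN1r.
  apply: SmoothAdd; first exact: smooth_ramp.
  by apply: SmoothMul; [exact: SmoothCst|exact: smooth_ramp].
- apply: subclosed_compact sub; first exact: closed_closure.
  exact: segment_compact.
- apply: subset_trans sub _ => x /=; rewrite !in_itv/= => /andP[ax xb].
  by apply/andP; split; lra.
Qed.

(** Dominated convergence with bound |g|. A ramp vanishes at its starting point, so the pointwise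
    limit is the indicator of an interval open at a and closed at b. *)
Lemma ramp_indic_cvg c d a b g : a <= b -> leb.-integrable `]c, d[ (EFin \o g) ->
  \int[leb]_(x in `]c, d[) (g x * (ramp a n.+1%:R x - ramp b n.+1%:R x)) @[n --> \oo]
  --> \int[leb]_(x in `]c, d[) (g x * \1_(`]a, b]) x).
Proof.
move=> ab gi; have mg : measurable_fun `]c, d[ g.
  by case/integrableP : gi => /measurable_EFinP.
have mr n : measurable_fun (`]c, d[ : set R)
    (fun x => ramp a n.+1%:R x - ramp b n.+1%:R x).
  have cr : continuous (fun x => ramp a n.+1%:R x - ramp b n.+1%:R x).
    by move=> x; apply: cvgB; exact: continuous_ramp.
  exact: (measurable_funTS (continuous_measurable_fun cr)).
have mI : measurable_fun (`]c, d[ : set R) (\1_(`]a, b] : set R) : R -> R).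
  by have := @measurable_indic _ R R (`]c, d[) (`]a, b]); apply.
have gI : leb.-integrable `]c, d[ (EFin \o (fun x => g x * \1_(`]a, b]) x)).
  apply: le_integrable gi => //.
    apply/measurable_EFinP; apply: measurable_funM mI; exact: mg.
  move=> x _; rewrite /= lee_fin normrM ler_piMr// indicE.
  by case: (_ \in _); rewrite ?normr1 ?normr0.
apply: fine_cvg; rewrite fineK; last exact: integrable_fin_num.
apply: (@dominated_cvg _ _ R leb (`]c, d[) _
  (fun n x => (g x * (ramp a n.+1%:R x - ramp b n.+1%:R x))%:E)
  (fun x => (g x * \1_(`]a, b]) x)%:E) (fun x => `|g x|%:E)) => //.
- by move=> n; apply/measurable_EFinP; apply: measurable_funM (mr n); exact: mg.
- move=> x _; apply: cvg_EFin; first exact: nearW.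
  apply: cvg_near_cst; rewrite indicE.
  have near_eq1 z : z < x -> \forall n \near \oo, ramp z n.+1%:R x = 1.
    move=> zx; have xz0 : 0 < x - z by rewrite subr_gt0.
    near=> n; apply: ramp_eq1 => //; rewrite -lerBrDl ltW//.
    by near: n; exact: (near_infty_natSinv_lt (PosNum xz0)).
  case: (leP x a) => xa.
    rewrite memNset ?mulr0/=; last by rewrite in_itv/= ltNge xa.
    by near=> n; rewrite !ramp_eq0 ?subrr ?mulr0//; lra.
  case: (leP x b) => xb.
    rewrite mem_set/= ?in_itv/= ?xa//.
    near=> n; rewrite (ramp_eq0 (a := b))// subr0; congr (_ * _).
    by near: n; exact: near_eq1.
  rewrite memNset ?mulr0/=; last by rewrite in_itv/= xa leNgt xb.
  near=> n; have -> : ramp a n.+1%:R x = 1 by near: n; exact: near_eq1.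
  have -> : ramp b n.+1%:R x = 1 by near: n; exact: near_eq1.
  by rewrite subrr mulr0.
- exact: integrable_norm.
- move=> n x _; rewrite /= lee_fin normrM ler_piMr//.
  have := ramp_itv a n.+1%:R x; have := ramp_itv b n.+1%:R x.
  by rewrite ler_norml => /andP[? ?] /andP[? ?]; apply/andP; split; lra.
Unshelve. all: by end_near. Qed.

(** With the difference of the ramps at a and b as test function, the integral of u against its
    derivative tends to [u a - u b], and the other side to minus the integral of g over ]a, b]. *)
Lemma weak_derivative_ftc_oo c d u g a b : {within `[c, d], continuous u} ->
  leb.-integrable `]c, d[ (EFin \o g) -> weak_derivative c d u g ->
  c < a -> a <= b -> b < d -> \int[leb]_(x in `]a, b]) g x = u b - u a.
Proof.
move=> uc gi [_ _ ug] ca ab bd.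
have cbd : c < b < d by rewrite bd andbT; lra.
have cad : c < a < d by rewrite ca; lra.
have Lu := cvgB (FF := eventually_filter) (ramp_mean_cvg cbd uc) (ramp_mean_cvg cad uc).
have Lg := ramp_indic_cvg ab gi.
have -> : \int[leb]_(x in `]a, b]) g x = \int[leb]_(x in `]c, d[) (g x * \1_(`]a, b]) x).
  have -> : `]a, b]%classic = `]c, d[%classic `&` `]a, b]%classic.
    apply/esym/setIidr => x /=; rewrite !in_itv/= => /andP[ax xb].
    by apply/andP; split; lra.
  rewrite Rintegral_mkcondr; apply: eq_Rintegral => x _.
  rewrite patchE indicE setIidr; last first.
    move=> y /=; rewrite !in_itv/= => /andP[ay yb]; by apply/andP; split; lra.
  by case: ifP; rewrite ?mulr1 ?mulr0.
suff Lg' : \int[leb]_(x in `]c, d[)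
    (g x * (ramp a n.+1%:R x - ramp b n.+1%:R x)) @[n --> \oo] --> u b - u a.
  exact: (cvg_unique (@Rhausdorff R) Lg Lg').
(* The test function is admissible only once b + 1/(n+1) < d, so the identity is shown for large
   n. *)
suff E : \forall n \near \oo,
    \int[leb]_(x in `]c, d[) (u x * derive1 (ramp b n.+1%:R) x) -
    \int[leb]_(x in `]c, d[) (u x * derive1 (ramp a n.+1%:R) x) =
    \int[leb]_(x in `]c, d[) (g x * (ramp a n.+1%:R x - ramp b n.+1%:R x)).
  exact: (cvg_trans (near_eq_cvg (FF := eventually_filter) E) Lu).
have bd0 : 0 < d - b by rewrite subr_gt0.
near=> n.
have n0 : 0 < n.+1%:R :> R by [].
have bdn : b + n.+1%:R^-1 < d.
  by rewrite -ltrBrDl; near: n; exact: (near_infty_natSinv_lt (PosNum bd0)).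
have := ug _ (test_function_ramp n0 ca ab bdn).
have -> : derive1 (fun x => ramp a n.+1%:R x - ramp b n.+1%:R x) =
    fun x => derive1 (ramp a n.+1%:R) x - derive1 (ramp b n.+1%:R) x.
  apply: derive1_is_derive => x; rewrite !derive1_ramp.
  by apply: is_deriveB; exact: ramp_is_derive.
move=> E; rewrite -[RHS]opprK -E.
have ui z : leb.-integrable `]c, d[ (EFin \o (fun x => u x * derive1 (ramp z n.+1%:R) x)).
  apply/integrable_oo/integrable_continuous/continuous_within_mul => //.
  exact: continuous_derive1_ramp.
rewrite -opprB -RintegralB//; congr (- _).
by apply: eq_Rintegral => x _; rewrite mulrBr.
Unshelve. all: by end_near. Qed.

(** Test functions do not reach the end points c and d. The difference of u and the indefinite
    integral of g is constant in the interior, and continuity extends this to [c, d]. *)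
Lemma weak_derivative_ftc c d u g a b : {within `[c, d], continuous u} ->
  leb.-integrable `]c, d[ (EFin \o g) -> weak_derivative c d u g ->
  c <= a -> a <= b -> b <= d -> \int[leb]_(x in `]a, b]) g x = u b - u a.
Proof.
move=> uc gi ug; have gi' := integrable_itv_cc gi.
have [dc|cd] := leP d c.
  move=> ca ab bd; have -> : a = b by lra.
  by rewrite set_itvoc0// Rintegral_set0 subrr.
pose G x := \int[leb]_(t in `[c, x]) g t.
have Gc : {within `[c, d], continuous G}.
  exact: parameterized_integral_continuous (ltW cd) gi'.
have GB x y : c <= x -> x <= y -> y <= d -> \int[leb]_(t in `]x, y]) g t = G y - G x.
  move=> cx xy yd; rewrite Rintegral_itvB//.
  by apply: integrableS gi' => //; apply: subset_itvl; rewrite bnd_simp.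
pose w := (u \- G) : R -> R.
have wc : {within `[c, d], continuous w}.
  by move=> x; apply: cvgB; [exact: uc|exact: Gc].
pose m := (c + d) / 2.
have wm x : c < x -> x < d -> w x = w m.
  (* Every interior point is compared with the midpoint, from whichever side it lies. *)
  move=> cx xd; wlog xm : x cx xd / x <= m.
    move=> H; have [/H->//|mx] := leP x m.
    have := weak_derivative_ftc_oo uc gi ug (_ : c < m) (ltW mx) xd.
    rewrite GB ?(ltW mx)// ?(ltW xd)//; last by rewrite /m; lra.
    by move=> /(_ ltac:(rewrite /m; lra)); rewrite /w/=; lra.
  have := weak_derivative_ftc_oo uc gi ug cx xm (_ : m < d).
  rewrite GB ?(ltW cx)//; last by rewrite /m; lra.
  by move=> /(_ ltac:(rewrite /m; lra)); rewrite /w/=; lra.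
have [_ wcr wdl] := (continuous_within_itvP w cd).1 wc.
have wE x : c <= x -> x <= d -> w x = w m.
  rewrite le_eqVlt => /predU1P[<- _|cx].
    apply: (cvg_unique _ wcr); first exact: Rhausdorff.
    apply: cvg_near_cst; near=> y; apply: wm => //.
  rewrite le_eqVlt => /predU1P[->|xd]; last exact: wm.
  apply: (cvg_unique _ wdl); first exact: Rhausdorff.
  by apply: cvg_near_cst; near=> y; apply: wm => //.
move=> ca ab bd; rewrite GB//.
have := wE a ca (le_trans ab bd); have := wE b (le_trans ca ab) bd.
rewrite /w/=; lra.
Unshelve. all: by end_near. Qed.

End WeakFTC.

(** * Convexity and Jensen's inequality *)

Section Primitive.
Context {R : realType}.
Implicit Types (f g u : R -> R) (a b c l : R).

Lemma C1_increasing f : C1_increasing_away0 f -> {homo f : x y / x < y}.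
Proof.
move=> [fc fd].
(* The disjunction ensures that 0 lies outside ]x, y[, so the mean value theorem applies with a
   positive derivative; other intervals are cut at 0. *)
have H x y : x < y -> (0 < x) || (0 == x) || (y <= 0) -> f x < f y.
  move=> xy xy0.
  have [|z|z] := @MVT _ f (derive1 f) x y xy.
  - move=> z; rewrite in_itv/= => /andP[xz zy].
    have [|df _ _] := fd z; first by case/orP: xy0 => [/orP[|/eqP]|]; lra.
    by apply: DeriveDef => //; rewrite derive1E.
  - exact: continuous_subspaceT.
  - rewrite in_itv/= => /andP[xz zy] E.
    have [|_ _ dz] := fd z; first by case/orP: xy0 => [/orP[|/eqP]|]; lra.
    by rewrite -subr_gt0 E mulr_gt0// subr_gt0.
move=> x y xy; have [y0|y0] := leP y 0; first by apply: H => //; rewrite y0 orbT.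
have [x0|x0] := leP 0 x.
  by apply: H => //; rewrite orbC orbA orbC; case: ltgtP x0 => //=; lra.
apply: (@lt_trans _ _ (f 0)); first by apply: H => //; rewrite lexx orbT.
by apply: H => //; rewrite eqxx orbT.
Qed.

Lemma C1_increasing_le f : C1_increasing_away0 f -> {homo f : x y / x <= y}.
Proof. by move=> /C1_increasing/ltW_homo. Qed.

Lemma Rintegral_itv_split f a b c : a <= b -> b <= c ->
  leb.-integrable `[a, c] (EFin \o f) ->
  \int[leb]_(x in `[a, c]) f x =
  \int[leb]_(x in `[a, b]) f x + \int[leb]_(x in `[b, c]) f x.
Proof.
move=> ab bc fi; rewrite -(@Rintegral_itv_obnd_cbnd _ b).
  by rewrite -(Rintegral_itvB fi) ?bnd_simp//; ring.
by apply: integrableS fi => //; apply: subset_itvr; rewrite bnd_simp.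
Qed.

Lemma primitive0B f a b : continuous f -> a <= b ->
  primitive0 f b - primitive0 f a = \int[leb]_(x in `[a, b]) f x.
Proof.
move=> fc ab; have fi x y : leb.-integrable `[x, y] (EFin \o f).
  by apply: integrable_continuous; exact: continuous_subspaceT.
rewrite /primitive0; have [b0|b0] := leP 0 b; have [a0|a0] := leP 0 a.
- by rewrite (Rintegral_itv_split a0 ab)//; ring.
- by rewrite (Rintegral_itv_split (ltW a0) b0)//; ring.
- lra.
- by rewrite (Rintegral_itv_split ab (ltW b0))//; ring.
Qed.

Lemma primitive0_0 f : primitive0 f 0 = 0.
Proof. by rewrite /primitive0 lexx set_itv1 Rintegral_set1. Qed.

Lemma Rintegral_itv_cst a b c : a <= b -> \int[leb]_(x in `[a, b]) c = c * (b - a).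
Proof.
move=> ab; rewrite Rintegral_cst//= lebesgue_measure_itv/= lte_fin.
by case: ltgtP ab => //= ->; rewrite subrr.
Qed.

Lemma integrable_cst a b c : leb.-integrable `[a, b] (EFin \o (fun=> c)).
Proof.
by apply: integrable_continuous; apply: continuous_subspaceT => x; exact: cvg_cst.
Qed.

(** Convexity of the primitive of a nondecreasing function: the increment is an integral of f
    between a and b, where f is compared with [f b]. Jensen's inequality and both telescoping
    estimates rest on it. *)
Lemma primitive0_tangent f a b : continuous f -> {homo f : x y / x <= y} ->
  f b * (a - b) <= primitive0 f a - primitive0 f b.
Proof.
move=> fc fm; have fi x y : leb.-integrable `[x, y] (EFin \o f).
  by apply: integrable_continuous; exact: continuous_subspaceT.
have [ba|ab] := leP b a.
  rewrite primitive0B// -Rintegral_itv_cst//; apply: le_Rintegral => //.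
    exact: integrable_cst.
  by move=> x; rewrite /= in_itv/= => /andP[bx _]; exact: fm.
rewrite -lerN2 opprB -mulrN opprB primitive0B ?(ltW ab)// -Rintegral_itv_cst ?(ltW ab)//.
apply: le_Rintegral => //; first exact: integrable_cst.
by move=> x; rewrite /= in_itv/= => /andP[_ xb]; exact: fm.
Qed.

Lemma primitive0_ge0 f a : continuous f -> {homo f : x y / x <= y} -> f 0 = 0 ->
  0 <= primitive0 f a.
Proof.
move=> fc fm f0; have := primitive0_tangent a 0 fc fm.
by rewrite f0 mul0r primitive0_0 subr0.
Qed.

Section Jensen.
Variables (mu : R -> R) (mu_incr : C1_increasing_away0 mu) (mu0 : mu 0 = 0).
Let muc : continuous mu. Proof. by case: mu_incr. Qed.
Let mum := C1_increasing_le mu_incr.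

(** The tangents of the convex primitive at 1 and -1 have slopes of opposite sign and so control x
    from above and from below; K adds the reciprocals of the absolute slopes. *)
Lemma primitive0_linear_growth : exists2 K, 0 < K &
  forall x, `|x| <= 1 + K * primitive0 mu x.
Proof.
have m1 : 0 < mu 1 by rewrite -mu0; apply: C1_increasing.
have mN1 : mu (-1) < 0 by rewrite -mu0; apply: C1_increasing; rewrite // ltrN10.
have M1 := primitive0_ge0 1 muc mum mu0.
have MN1 := primitive0_ge0 (-1) muc mum mu0.
exists ((mu 1)^-1 + (- mu (-1))^-1); first by rewrite addr_gt0 ?invr_gt0 ?oppr_gt0.
move=> x; have Mx := primitive0_ge0 x muc mum mu0.
have T1 := primitive0_tangent x 1 muc mum.
have TN1 := primitive0_tangent x (-1) muc mum.
have i1 : 0 <= (mu 1)^-1 * primitive0 mu x by rewrite mulr_ge0// invr_ge0 ltW.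
have i2 : 0 <= (- mu (-1))^-1 * primitive0 mu x.
  by rewrite mulr_ge0// invr_ge0 oppr_ge0 ltW.
have j1 : x - 1 <= (mu 1)^-1 * primitive0 mu x by rewrite ler_pdivlMl//; lra.
have j2 : - x - 1 <= (- mu (-1))^-1 * primitive0 mu x.
  by rewrite ler_pdivlMl ?oppr_gt0//; lra.
by rewrite ler_norml mulrDl; apply/andP; split; lra.
Qed.

(** A weak derivative is only locally integrable in the open interval; the linear growth of
    [primitive0 mu] gives integrability up to the end points. *)
Lemma integrable_of_primitive0 a b g : measurable_fun `]a, b[ g ->
  leb.-integrable `]a, b[ (EFin \o (primitive0 mu \o g)) ->
  leb.-integrable `]a, b[ (EFin \o g).
Proof.
move=> mg Mgi; have [K K0 KM] := primitive0_linear_growth.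
have ci := integrable_oo (integrable_cst a b 1).
have KMi : leb.-integrable `]a, b[ (EFin \o (fun x => K * primitive0 mu (g x))).
  by apply: (integrableZl _ K Mgi).
have si : leb.-integrable `]a, b[ (EFin \o (fun x => 1 + K * primitive0 mu (g x))).
  by apply: (integrableD _ ci KMi).
apply: le_integrable si => //; first exact/measurable_EFinP.
move=> x _; rewrite /= lee_fin (le_trans (KM _))// ler_norm//.
Qed.

(** The tangent inequality at s is integrated; the linear term drops out because s is the mean of
    g. *)
Lemma jensen_itv a b g : a < b -> leb.-integrable `]a, b] (EFin \o g) ->
  leb.-integrable `]a, b] (EFin \o (primitive0 mu \o g)) ->
  (b - a) * primitive0 mu ((\int[leb]_(x in `]a, b]) g x) / (b - a)) <=
  \int[leb]_(x in `]a, b]) primitive0 mu (g x).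
Proof.
move=> ab gi Mi; set s := _ / (b - a).
have ci c : leb.-integrable `]a, b] (EFin \o (fun=> c)).
  by apply: integrableS (integrable_cst a b c) => //; exact: subset_itv_oc_cc.
have cE c : \int[leb]_(x in `]a, b]) c = c * (b - a).
  by rewrite Rintegral_itv_obnd_cbnd// Rintegral_itv_cst// ltW.
have si : leb.-integrable `]a, b] (EFin \o (fun x => mu s * g x)).
  by apply: (integrableZl _ (mu s) gi).
have ti : leb.-integrable `]a, b]
    (EFin \o (fun x => (primitive0 mu s - mu s * s) + mu s * g x)).
  by apply: (integrableD _ (ci _) si).
have <- : \int[leb]_(x in `]a, b]) (primitive0 mu s - mu s * s + mu s * g x) =
    (b - a) * primitive0 mu s.
  rewrite RintegralD// cE RintegralZl//.
  have -> : \int[leb]_(x in `]a, b]) g x = s * (b - a).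
    by rewrite /s divfK// gt_eqF// subr_gt0.
  ring.
apply: le_Rintegral => // x _; have := primitive0_tangent (g x) s muc mum; lra.
Qed.

Lemma jensen_partition (x : nat -> R) (d : R) n g u :
  (forall i, (i < n)%N -> x i < x i.+1) -> x n <= d ->
  leb.-integrable `]x 0%N, d] (EFin \o g) ->
  leb.-integrable `]x 0%N, d] (EFin \o (primitive0 mu \o g)) ->
  (forall i, (i < n)%N -> \int[leb]_(t in `]x i, x i.+1]) g t = u (x i.+1) - u (x i)) ->
  \sum_(i < n) (x i.+1 - x i) *
    primitive0 mu ((u (x i.+1) - u (x i)) / (x i.+1 - x i)) <=
  \int[leb]_(t in `]x 0%N, d]) primitive0 mu (g t).
Proof.
move=> xS xd gi Mi uE.
have xm i j : (i <= j)%N -> (j <= n)%N -> x i <= x j.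
  elim: j => [|j IH]; first by rewrite leqn0 => /eqP->.
  rewrite leq_eqVlt => /predU1P[->//|ij] jn.
  by rewrite (le_trans (IH ij (ltnW jn)))// ltW// xS.
have sub i j : (i <= j)%N -> (j <= n)%N -> `]x i, x j]%classic `<=` `]x 0%N, d]%classic.
  move=> ij jn t /=; rewrite !in_itv/= => /andP[t1 t2].
  rewrite (le_lt_trans (xm 0%N i _ (leq_trans ij jn)) t1)//=.
  by rewrite (le_trans t2)// (le_trans (xm j n _ _)).
have Ms i j : (i <= j)%N -> (j <= n)%N ->
    leb.-integrable `]x i, x j] (EFin \o (primitive0 mu \o g)).
  by move=> ij jn; apply: integrableS Mi => //; exact: sub.
apply: (@le_trans _ _ (\int[leb]_(t in `]x 0%N, x n]) primitive0 mu (g t))); last first.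
  rewrite -subr_ge0 (Rintegral_itvB Mi) ?bnd_simp ?xm//.
  by apply: Rintegral_ge0 => t _; exact: primitive0_ge0.
suff H k : (k <= n)%N -> \sum_(i < k) (x i.+1 - x i) *
      primitive0 mu ((u (x i.+1) - u (x i)) / (x i.+1 - x i)) <=
    \int[leb]_(t in `]x 0%N, x k]) primitive0 mu (g t) by exact: H.
elim: k => [_|k IH kn]; first by rewrite big_ord0 set_itvoc0 ?Rintegral_set0.
rewrite big_ord_recr/=.
have x0k : (BRight (x 0%N) <= BRight (x k))%O by rewrite bnd_simp xm// ltnW.
have xkS : (BRight (x k) <= BRight (x k.+1))%O by rewrite bnd_simp xm.
have E := Rintegral_itvB (Ms 0%N k.+1 isT kn) x0k xkS.
have gi' : leb.-integrable `]x k, x k.+1] (EFin \o g).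
  by apply: integrableS gi => //; exact: sub.
have := jensen_itv (xS _ kn) gi' (Ms k k.+1 (leqnSn k) kn).
by rewrite uE// -E; have := IH (ltnW kn); lra.
Qed.

End Jensen.
End Primitive.

(** * Nodal form of the integrals *)

Section Elements.
Context {R : realType}.
Implicit Types (f g u v : R -> R) (l : R) (N : nat).

Lemma integrable_setU_itv (a b c : R) f : a <= b -> b <= c ->
  leb.-integrable `[a, b] (EFin \o f) -> leb.-integrable `[b, c] (EFin \o f) ->
  leb.-integrable `[a, c] (EFin \o f).
Proof.
move=> ab bc fab fbc.
have fbc' : leb.-integrable `]b, c] (EFin \o f).
  by apply: integrableS fbc => //; exact: subset_itv_oc_cc.
move: fab fbc' => /integrableP[mab iab] /integrableP[mbc ibc].
have U : `[a, c]%classic = `[a, b]%classic `|` `]b, c]%classic.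
  by rewrite -itv_bndbnd_setU// bnd_simp.
have m : measurable_fun (`[a, c]%classic : set R) (EFin \o f).
  by rewrite U; apply/measurable_funU => //; split.
apply/integrableP; split => //.
have dis : [disjoint `[a, b]%classic & `]b, c]%classic].
  apply/disj_setPRL => x/=; rewrite !in_itv/= => /andP[bx _].
  by apply/negP; rewrite negb_and -!ltNge bx orbT.
have m' : measurable_fun (`[a, c]%classic : set R) (fun x => `|(EFin \o f) x|%E).
  exact: measurableT_comp.
rewrite U in m' *; rewrite ge0_integral_setU//=.
exact: lte_add_pinfty.
Unshelve. all: exact m'.
Qed.

Lemma Rintegral_sum (a b : R) n (F : nat -> R -> R) :
  (forall i, leb.-integrable `[a, b] (EFin \o F i)) ->
  leb.-integrable `[a, b] (EFin \o (fun x => \sum_(i < n) F i x)) /\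
  \int[leb]_(x in `[a, b]) (\sum_(i < n) F i x) =
  \sum_(i < n) \int[leb]_(x in `[a, b]) F i x.
Proof.
move=> Fi; elim: n => [|n [IHi IH]].
  have E : (fun x => \sum_(i < 0) F i x) = (fun=> 0).
    by apply/funext => x; rewrite big_ord0.
  by rewrite E big_ord0 Rintegral_cst// mul0r; split => //; exact: integrable_cst.
have E : (fun x => \sum_(i < n.+1) F i x) = (fun x => \sum_(i < n) F i x + F n x).
  by apply/funext => x; rewrite big_ord_recr.
rewrite E; split; first by apply: (integrableD _ IHi (Fi n)).
by rewrite big_ord_recr/= -IH -RintegralD.
Qed.

Variables (l : R) (N : nat) (l_gt0 : 0 < l) (N_gt0 : (0 < N)%N).
Notation h := (mesh l N).
Notation x_ := (node l N).

Lemma mesh_gt0 : 0 < h.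
Proof. by rewrite divr_gt0// ltr0n. Qed.

Lemma node0 : x_ 0 = 0. Proof. by rewrite /node mul0r. Qed.

Lemma nodeN : x_ N = l.
Proof. by rewrite /node /mesh mulrC divfK// pnatr_eq0 -lt0n. Qed.

Lemma nodeS i : x_ i.+1 = x_ i + h.
Proof. by rewrite /node -natr1 mulrDl mul1r. Qed.

Lemma node_lt i : x_ i < x_ i.+1.
Proof. by rewrite nodeS ltrDl mesh_gt0. Qed.

Lemma node_le i j : (i <= j)%N -> x_ i <= x_ j.
Proof. by move=> ij; rewrite ler_pM2r ?mesh_gt0// ler_nat. Qed.

Lemma node_itv i : (i <= N)%N -> 0 <= x_ i <= l.
Proof.
move=> iN; apply/andP; split; first by rewrite -[leLHS]node0 node_le.
by rewrite -[leRHS]nodeN node_le.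
Qed.

Lemma node_locate x : 0 <= x <= l -> exists2 i, (i < N)%N & x_ i <= x <= x_ i.+1.
Proof.
move=> /andP[x0 xl]; suff H n : (0 < n)%N -> x <= x_ n ->
    exists2 i, (i < n)%N & x_ i <= x <= x_ i.+1 by apply: H; rewrite ?nodeN.
elim: n => // n IH _ xn; have [xn'|nx] := leP x (x_ n); last first.
  by exists n => //; rewrite xn ltW.
case: n => [|n] in IH xn xn' *.
  by exists 0%N; rewrite // xn andbT node0.
by have [i ni xi] := IH isT xn'; exists i => //; exact: leq_trans ni _.
Qed.

Lemma affine_interpolation (p q a b a' b' x : R) : p < q ->
  a * p + b = a' * p + b' -> a * q + b = a' * q + b' -> a * x + b = a' * x + b'.
Proof.
move=> pq E1 E2; suff E : a = a' by move: E1; rewrite E; lra.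
have qp : q - p != 0 by rewrite gt_eqF// subr_gt0.
by apply: (mulIf qp); lra.
Qed.

(** On each element both sides are affine, and they agree at its two nodes. *)
Lemma Vh_interpolation v x : Vh l N v -> 0 <= x <= l -> v x = Ih l N v x.
Proof.
move=> [_ va] xl; have [i iN xi] := node_locate xl.
have [a [b vE]] := va i iN.
have [_ Ia] := Vh_Ih v l_gt0 N_gt0; have [a' [b' IE]] := Ia i iN.
rewrite vE// IE//; have xS := ltW (node_lt i).
have e1 : x_ i <= x_ i <= x_ i.+1 by rewrite lexx xS.
have e2 : x_ i <= x_ i.+1 <= x_ i.+1 by rewrite lexx xS.
by apply: (affine_interpolation _ (node_lt i)); rewrite -vE// -IE// Ih_node// ltnW.
Qed.

Lemma hat_ge0 i x : 0 <= hat l N i x.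
Proof. by rewrite /hat le_max lexx. Qed.

(** The constant 1 equals its own interpolant. *)
Lemma sum_hat x : 0 <= x <= l -> \sum_(i < N.+1) hat l N i x = 1.
Proof.
move=> xl; have V1 : Vh l N (fun=> 1).
  split; first by apply: continuous_subspaceT => y; exact: cvg_cst.
  by move=> i _; exists 0, 1 => y _; rewrite mul0r add0r.
rewrite [RHS](Vh_interpolation V1 xl) /Ih; apply: eq_bigr => i _.
by rewrite mul1r.
Qed.

Lemma Ih_itv f x (p q : R) : (forall i, (i <= N)%N -> p <= f (x_ i) <= q) ->
  0 <= x <= l -> p <= Ih l N f x <= q.
Proof.
move=> fpq xl; rewrite -[p]mulr1 -[q]mulr1 -(sum_hat xl) !mulr_sumr /Ih.
by apply/andP; split; apply: ler_sum => i _; rewrite ler_wpM2r ?hat_ge0//;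
  have /andP[] := fpq i (ltn_ord i).
Qed.

(** The hat functions at x are nonnegative and sum to 1; expanding the variance of the nodal values
    under these weights, which is nonnegative, gives the claim. *)
Lemma Ih_sqr_le f x : 0 <= x <= l -> Ih l N f x ^+ 2 <= Ih l N (fun y => f y * f y) x.
Proof.
move=> xl; have [m mE] : exists m, m = Ih l N f x by exists (Ih l N f x).
rewrite -mE.
have : 0 <= \sum_(i < N.+1) (f (x_ i) - m) ^+ 2 * hat l N i x.
  by apply: sumr_ge0 => i _; rewrite mulr_ge0 ?sqr_ge0 ?hat_ge0.
have -> : \sum_(i < N.+1) (f (x_ i) - m) ^+ 2 * hat l N i x =
    \sum_(i < N.+1) f (x_ i) * f (x_ i) * hat l N i x +
    - (2 * m) * (\sum_(i < N.+1) f (x_ i) * hat l N i x) +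
    m ^+ 2 * \sum_(i < N.+1) hat l N i x.
  by rewrite !mulr_sumr -!big_split/=; apply: eq_bigr => i _; ring.
rewrite sum_hat// -/(Ih l N (fun y => f y * f y) x) -/(Ih l N f x) -mE; lra.
Qed.

Definition slope u i := (u (x_ i.+1) - u (x_ i)) / h.

Lemma derive1_element v i x : (i < N)%N -> Vh l N v -> x_ i < x < x_ i.+1 ->
  derive1 v x = slope v i.
Proof.
move=> iN [_ va] /andP[xi xi']; have [a [b vE]] := va i iN.
have -> : slope v i = a.
  rewrite /slope !vE ?lexx ?(ltW (node_lt i))// nodeS; field.
  by rewrite gt_eqF// mesh_gt0.
have near_v : \near x, a * x + b = v x.
  near=> y; rewrite vE//; apply/andP; split; apply: ltW; near: y.
    exact: lt_nbhsr.
  exact: lt_nbhsl.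
rewrite derive1E -(near_eq_derive _ near_v).
have := is_deriveD (is_deriveZ a (is_derive_id x 1)) (is_derive_cst b x 1).
by move=> d; rewrite (@derive_val _ _ _ _ _ _ _ d) addr0 /GRing.scale/= mulr1.
Unshelve. all: by end_near. Qed.

(** The values of F at the nodes are left free, since derivatives in [Vh] have no meaning there.
    Integrability is carried through the induction because splitting the integral requires it. *)
Lemma Rintegral_elements F (c : nat -> R) :
  (forall i x, (i < N)%N -> x_ i < x < x_ i.+1 -> F x = c i) ->
  \int[leb]_(x in `[0, l]) F x = \sum_(i < N) h * c i.
Proof.
move=> Fc; suff H n : (n <= N)%N -> leb.-integrable `[x_ 0, x_ n] (EFin \o F) /\
  \int[leb]_(x in `[x_ 0, x_ n]) F x = \sum_(i < n) h * c i.
  by have [_] := H N (leqnn N); rewrite node0 nodeN.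
elim: n => [_|n IH nN].
  split; last by rewrite big_ord0 set_itv1 Rintegral_set1.
  by apply: integrable_itv_cc; rewrite set_itvoo0//; exact: integrable_set0.
have [Fi IE] := IH (ltnW nN).
have ci : leb.-integrable `[x_ n, x_ n.+1] (EFin \o F).
  apply: integrable_itv_cc.
  apply: eq_integrable (integrable_oo (integrable_cst _ _ (c n))) => //.
  by move=> x; rewrite inE/= in_itv/= => xn; rewrite (Fc n).
have Fi' := integrable_setU_itv (node_le (leq0n n)) (ltW (node_lt n)) Fi ci.
split => //; rewrite (Rintegral_itv_split (node_le (leq0n n)) (ltW (node_lt n)) Fi').
rewrite big_ord_recr/= IE; congr (_ + _).
rewrite Rintegral_cc_oo// (eq_Rintegral _ (g := fun=> c n)); last first.
  by move=> x; rewrite inE/= in_itv/= => xn; rewrite (Fc n).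
rewrite -Rintegral_cc_oo; last exact: integrable_cst.
by rewrite Rintegral_itv_cst ?(ltW (node_lt n))// nodeS; ring.
Qed.

Lemma ip_slope (mu : R -> R) u v : Vh l N u -> Vh l N v ->
  ip l (mu \o derive1 u) (derive1 v) =
  \sum_(i < N) mu (slope u i) * (v (x_ i.+1) - v (x_ i)).
Proof.
move=> Vu Vv; rewrite /ip (@Rintegral_elements _ (fun i => mu (slope u i) * slope v i)).
  apply: eq_bigr => i _; rewrite /slope; field.
  by rewrite gt_eqF// mesh_gt0.
by move=> i x iN xi /=; rewrite !(derive1_element iN).
Qed.

Lemma Rintegral_slope (M : R -> R) u : Vh l N u ->
  \int[leb]_(x in `[0, l]) M (derive1 u x) = \sum_(i < N) h * M (slope u i).
Proof.
move=> Vu; apply: (Rintegral_elements (F := M \o derive1 u) (c := M \o slope u)).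
move=> i x iN xi.
by rewrite /= (derive1_element iN).
Qed.

Definition weight (i : nat) : R := \int[leb]_(x in `[0, l]) hat l N i x.

Lemma weight_ge0 i : 0 <= weight i.
Proof. by apply: Rintegral_ge0 => x _; exact: hat_ge0. Qed.

Lemma integrable_hat i : leb.-integrable `[0, l] (EFin \o hat l N i).
Proof.
by apply: integrable_continuous; apply: continuous_subspaceT; exact: continuous_hat.
Qed.

Lemma Rintegral_Ih f :
  leb.-integrable `[0, l] (EFin \o Ih l N f) /\
  \int[leb]_(x in `[0, l]) Ih l N f x = \sum_(i < N.+1) weight i * f (x_ i).
Proof.
have hi i : leb.-integrable `[0, l] (EFin \o (fun x => f (x_ i) * hat l N i x)).
  by apply: (integrableZl _ (f (x_ i)) (integrable_hat i)).
have [? E] := Rintegral_sum N.+1 hi; split => //.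
rewrite E; apply: eq_bigr => i _.
by rewrite RintegralZl// 1?mulrC//; exact: integrable_hat.
Qed.

Lemma sum_weight : \sum_(i < N.+1) weight i = l.
Proof.
have [_] := Rintegral_Ih (fun=> 1).
under [in RHS]eq_bigr do rewrite mulr1.
move=> <-; rewrite (eq_Rintegral _ (g := fun=> 1)).
  by rewrite Rintegral_itv_cst ?ltW// mul1r subr0.
move=> x; rewrite inE/= in_itv/= => xl; rewrite /Ih.
by under eq_bigr do rewrite mul1r; exact: sum_hat.
Qed.

Lemma ip_hE f g : ip_h l N f g = \sum_(i < N.+1) weight i * (f (x_ i) * g (x_ i)).
Proof. exact: (Rintegral_Ih _).2. Qed.

(** Mass lumping can only increase the squared norm, by the pointwise bound on the square of an
    interpolant. The lumped time term thus controls the exact norm. *)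
Lemma L2norm_sq_le v : (forall x, 0 <= x <= l -> v x = Ih l N v x) ->
  L2norm_sq l v <= \sum_(i < N.+1) weight i * v (x_ i) ^+ 2.
Proof.
move=> vE; rewrite /L2norm_sq /ip.
have -> : \int[leb]_(x in `[0, l]) (v x * v x) =
    \int[leb]_(x in `[0, l]) (Ih l N v x ^+ 2).
  by apply: eq_Rintegral => x; rewrite inE/= in_itv/= => xl; rewrite vE.
have [i <-] := Rintegral_Ih (fun y => v y ^+ 2).
apply: le_Rintegral => //.
  apply: integrable_continuous => x; have [c _] := Vh_Ih v l_gt0 N_gt0.
  by apply: cvgM; exact: c.
by move=> x; rewrite /= in_itv/= => xl; exact: Ih_sqr_le.
Qed.

End Elements.

(** * Discrete estimates *)

Section DiscreteEstimates.
Context {R : realType}.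

(** U and V stand for the nodal values at the new and the old time, e0 and e1 for the boundary data.
    All three groups are nonnegative, hence zero. The boundary group then forces U 0 <= c, and a
    passage from U i <= c to U i.+1 > c would make its flux term positive. *)
Lemma discrete_max (b m : R -> R) (w U V : nat -> R) (N : nat) (h alpha c e0 e1 : R) :
  {homo b : x y / x <= y} -> {homo m : x y / x < y} -> m 0 = 0 ->
  (forall i, 0 <= w i) -> 0 < h -> 0 < alpha ->
  (forall i, (i <= N)%N -> V i <= c) -> e0 <= c -> e1 <= c ->
  \sum_(i < N.+1) w i * ((b (U i) - b (V i)) * Num.max 0 (U i - c)) +
  \sum_(i < N) m ((U i.+1 - U i) / h) *
    (Num.max 0 (U i.+1 - c) - Num.max 0 (U i - c)) +
  alpha * ((U 0%N - e0) * Num.max 0 (U 0%N - c) +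
           (U N - e1) * Num.max 0 (U N - c)) <= 0 ->
  forall i, (i <= N)%N -> U i <= c.
Proof.
move=> bm mm m0 w0 h0 a0 Vc e0c e1c.
have p0 (x : R) : 0 <= Num.max 0 x by rewrite le_max lexx.
have pp (x : R) : 0 < x -> Num.max 0 x = x by move=> ?; rewrite max_r// ltW.
have pn (x : R) : x <= 0 -> Num.max 0 x = 0 by move=> ?; rewrite max_l.
have mpos x : 0 < x -> 0 < m (x / h).
  by move=> x0; rewrite -m0; apply: mm; rewrite divr_gt0.
have mneg x : x < 0 -> m (x / h) < 0.
  by move=> x0; rewrite -m0; apply: mm; rewrite pmulr_llt0// invr_gt0.
have A0 : 0 <= \sum_(i < N.+1) w i * ((b (U i) - b (V i)) * Num.max 0 (U i - c)).
  apply: sumr_ge0 => i _; apply: mulr_ge0; first exact: w0.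
  have [Uc|cU] := leP (U i) c; first by rewrite pn ?mulr0// subr_le0.
  rewrite mulr_ge0// subr_ge0 bm// (le_trans (Vc i (ltn_ord i)))// ltW//.
have t0 i : 0 <= m ((U i.+1 - U i) / h) *
    (Num.max 0 (U i.+1 - c) - Num.max 0 (U i - c)).
  have [ltU|ltU|->] := ltgtP (U i) (U i.+1); last by rewrite !subrr mulr0.
    rewrite mulr_ge0 ?(ltW (mpos _ _)) ?subr_gt0// subr_ge0.
    by rewrite ge_max p0/= le_max lerB ?orbT// ltW.
  rewrite mulr_le0 ?(ltW (mneg _ _)) ?subr_lt0// subr_le0.
  by rewrite ge_max p0/= le_max lerB ?orbT// ltW.
have B0 : 0 <= \sum_(i < N) m ((U i.+1 - U i) / h) *
    (Num.max 0 (U i.+1 - c) - Num.max 0 (U i - c)) by apply: sumr_ge0 => i _.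
have c0 (x e : R) : e <= c -> 0 <= (x - e) * Num.max 0 (x - c).
  move=> ec; have [xc|cx] := leP x c; first by rewrite pn ?mulr0// subr_le0.
  by rewrite mulr_ge0// subr_ge0 (le_trans ec)// ltW.
move=> H.
have C0 := c0 (U 0%N) e0 e0c; have C1 := c0 (U N) e1 e1c.
have CC : 0 <= alpha * ((U 0%N - e0) * Num.max 0 (U 0%N - c) +
    (U N - e1) * Num.max 0 (U N - c)) by rewrite mulr_ge0 ?addr_ge0// ltW.
have Bz : \sum_(i < N) m ((U i.+1 - U i) / h) *
    (Num.max 0 (U i.+1 - c) - Num.max 0 (U i - c)) = 0 by lra.
have Cz : alpha * ((U 0%N - e0) * Num.max 0 (U 0%N - c) +
    (U N - e1) * Num.max 0 (U N - c)) = 0 by lra.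
elim=> [_|i IH iN].
  rewrite leNgt; apply/negP => cU.
  have : 0 < (U 0%N - e0) * Num.max 0 (U 0%N - c).
    by rewrite pp ?subr_gt0// mulr_gt0 ?subr_gt0// (le_lt_trans e0c).
  by move/eqP: Cz; rewrite mulf_eq0 (gt_eqF a0)/= => /eqP; lra.
have Uc := IH (ltnW iN); rewrite leNgt; apply/negP => cU.
have /psumr_eq0P : forall j : 'I_N, true -> 0 <= m ((U j.+1 - U j) / h) *
    (Num.max 0 (U j.+1 - c) - Num.max 0 (U j - c)) by [].
move=> /(_ Bz (Ordinal iN) isT)/=; rewrite pp ?subr_gt0// (pn (U i - c)) ?subr_le0//.
move/eqP; rewrite subr0 mulf_eq0 !gt_eqF ?subr_gt0// mpos// subr_gt0.
exact: le_lt_trans cU.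
Qed.

Lemma telescope_le (a E : nat -> R) (c : R) n :
  (forall k, (0 < k)%N -> a k <= c + (E k.-1 - E k)) ->
  \sum_(1 <= k < n.+1) a k <= n%:R * c + (E 0%N - E n).
Proof.
move=> aE; elim: n => [|n IH]; first by rewrite big_geq// mul0r subrr addr0.
rewrite big_nat_recr//= -natr1; have := aE n.+1 isT => /=; lra.
Qed.

Lemma lipschitz_onP (f : R -> R) (A : set R) : lipschitz_on f (globally (A `*` A)) ->
  exists2 L, 0 <= L & forall s t, A s -> A t -> `|f s - f t| <= L * `|s - t|.
Proof.
(* The Lipschitz bound holds for every constant beyond K; the witness exceeds K and is
   nonnegative. *)
move=> [K [_ KP]]; exists (Num.max K 0 + 1); first by rewrite addr_ge0// le_max lexx orbT.
move=> s t As At; apply: (KP _ _ (s, t)) => //.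
by rewrite (@le_lt_trans _ _ (Num.max K 0)) ?le_max ?lexx// ltrDl.
Qed.

(** Since p > 0, the interval [p, q] avoids the point where beta may fail to be differentiable; c is
    the minimum of the derivative over [p, q]. *)
Lemma strongly_monotone (beta : R -> R) (p q : R) : C1_increasing_away0 beta ->
  0 < p -> p <= q -> exists2 c, 0 < c & forall x y, p <= x <= q -> p <= y <= q ->
    c * (x - y) ^+ 2 <= (beta x - beta y) * (x - y).
Proof.
move=> [bc bd] p0 pq.
have dc : {within `[p, q], continuous (derive1 beta)}.
  apply: continuous_in_subspaceT => x; rewrite inE/= in_itv/= => /andP[px _].
  by have [|_ ? _] := bd x; first lra.
have [z] := EVT_min pq dc; rewrite in_itv/= => /andP[pz zq] zmin.
exists (derive1 beta z); first by have [|] := bd z; first lra.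
move=> x y; wlog xy : x y / y < x.
  move=> H xpq ypq; have [xy|yx|->] := ltgtP x y; last by rewrite !subrr expr0n/= !mulr0.
    by have := H y x xy ypq xpq; lra.
  exact: H.
move=> /andP[px xq] /andP[py yq].
have [|t|t] := @MVT _ beta (derive1 beta) y x xy.
- move=> t; rewrite in_itv/= => /andP[yt tx].
  have [|df _ _] := bd t; first lra.
  by apply: DeriveDef => //; rewrite derive1E.
- exact: continuous_subspaceT.
- rewrite in_itv/= => /andP[yt tx] ->.
  have : derive1 beta z <= derive1 beta t by apply: zmin; rewrite in_itv/=; lra.
  by rewrite -mulrA -expr2; apply: ler_wpM2r; exact: sqr_ge0.
Qed.

End DiscreteEstimates.

(** * Pointwise bounds and dissipation for the scheme *)

Section Scheme.
Context {R : realType}.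
Variables (l alpha T : R) (beta mu u0 : R -> R) (ud : R -> R -> R) (umin umax : R).
Hypotheses (l_gt0 : 0 < l) (alpha_gt0 : 0 < alpha).
Hypotheses (beta_incr : C1_increasing_away0 beta) (mu_incr : C1_increasing_away0 mu).
Hypothesis mu0 : mu 0 = 0.
Hypothesis umin_gt0 : 0 < umin.
Hypothesis u0_bnd : forall x, 0 <= x <= l -> umin <= u0 x <= umax.
Hypothesis ud_bnd : forall t x, 0 < t -> x = 0 \/ x = l -> umin <= ud t x <= umax.
Variables (N : nat) (tau : R) (u : nat -> R -> R).
Hypotheses (N_gt0 : (0 < N)%N) (tau_gt0 : 0 < tau).
Hypothesis u_sol : discrete_solution l alpha beta mu u0 ud N tau u.

Notation h := (mesh l N).
Notation x_ := (node l N).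
Notation w_ := (weight l N).
Notation M := (primitive0 mu).
Let betac : continuous beta. Proof. by case: beta_incr. Qed.
Let betam := C1_increasing_le beta_incr.
Let muc : continuous mu. Proof. by case: mu_incr. Qed.
Let mum := C1_increasing_le mu_incr.

Lemma time_gt0 k : (0 < k)%N -> 0 < time tau k.
Proof. by move=> k0; rewrite mulr_gt0// ltr0n. Qed.

Lemma ud_left t : 0 < t -> umin <= ud t 0 <= umax.
Proof. by move=> t0; apply: ud_bnd => //; left. Qed.

Lemma ud_right t : 0 < t -> umin <= ud t l <= umax.
Proof. by move=> t0; apply: ud_bnd => //; right. Qed.

Lemma Vh_solution k : Vh l N (u k).
Proof.
have [uI us] := u_sol; case: k => [|k]; last by case: (us k.+1 isT).
have [Ic Ia] := Vh_Ih u0 l_gt0 N_gt0; split.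
  apply: subspace_eq_continuous Ic => x; rewrite inE/= in_itv/= => xl.
  exact/esym/uI.
move=> i iN; have [a [b IE]] := Ia i iN; exists a, b => x xi.
rewrite uI ?IE//; have /andP[xi0 _] := node_itv l_gt0 N_gt0 (ltnW iN).
have /andP[_ xil] := node_itv l_gt0 N_gt0 iN.
by move: xi => /andP[? ?]; apply/andP; split; lra.
Qed.

(** Any f is allowed because it enters through its interpolant, which has the same nodal values; a
    positive part such as (u - umax)^+ need not lie in [Vh]. *)
Lemma scheme_nodal k f : (0 < k)%N ->
  \sum_(i < N.+1) w_ i *
    ((tau^-1 * (beta (u k (x_ i)) - beta (u k.-1 (x_ i)))) * f (x_ i)) +
  \sum_(i < N) mu (slope l N (u k) i) * (f (x_ i.+1) - f (x_ i)) +
  alpha * ((u k (x_ 0) - ud (time tau k) 0) * f (x_ 0) +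
           (u k (x_ N) - ud (time tau k) l) * f (x_ N)) = 0.
Proof.
move=> k0; have [_ /(_ k k0)[_ /(_ _ (Vh_Ih f l_gt0 N_gt0))]] := u_sol.
have If i : (i <= N)%N -> Ih l N f (x_ i) = f (x_ i) by exact: Ih_node.
rewrite ip_hE// (ip_slope l_gt0 N_gt0 mu (Vh_solution k) (Vh_Ih f l_gt0 N_gt0)).
have -> : \sum_(i < N.+1) w_ i * (dtau tau (fun j => beta \o u j) k (x_ i) *
    Ih l N f (x_ i)) = \sum_(i < N.+1) w_ i *
    ((tau^-1 * (beta (u k (x_ i)) - beta (u k.-1 (x_ i)))) * f (x_ i)).
  by apply: eq_bigr => i _; rewrite If// -ltnS.
have -> : \sum_(i < N) mu (slope l N (u k) i) * (Ih l N f (x_ i.+1) - Ih l N f (x_ i)) =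
    \sum_(i < N) mu (slope l N (u k) i) * (f (x_ i.+1) - f (x_ i)).
  by apply: eq_bigr => i _; rewrite !If// ltnW.
have := If 0%N isT; have := If N (leqnn N).
rewrite /bdry (node0 l N) (nodeN l N_gt0) => -> ->; lra.
Qed.

Lemma nodal_le k i : (i <= N)%N -> u k (x_ i) <= umax.
Proof.
elim: k i => [|k IH] i iN.
  rewrite u_sol.1 ?node_itv// Ih_node//.
  by have /andP[] := u0_bnd (node_itv l_gt0 N_gt0 iN).
have /andP[_ e0] := ud_left (time_gt0 (ltn0Sn k)).
have /andP[_ e1] := ud_right (time_gt0 (ltn0Sn k)).
have h0 := mesh_gt0 l_gt0 N_gt0.
have S := scheme_nodal (fun x => Num.max 0 (u k.+1 x - umax)) (ltn0Sn k).
(* The factor 1/tau is absorbed into the monotone function. *)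
apply: (@discrete_max R (fun x => tau^-1 * beta x) mu w_ (fun i => u k.+1 (x_ i))
  (fun i => u k (x_ i)) N h alpha umax
  (ud (time tau k.+1) 0) (ud (time tau k.+1) l)) => //.
- by move=> x y xy; rewrite ler_pM2l ?invr_gt0// betam.
- exact: C1_increasing.
- by move=> j; exact: weight_ge0.
rewrite le_eqVlt -[X in _ == X]S; apply/orP; left; apply/eqP; congr (_ + _ + _).
by apply: eq_bigr => j _; rewrite mulrBr.
Qed.

(** The reflection u -> -u turns the lower bound into an upper bound for the scheme with -beta(-x)
    and -mu(-x), which are again increasing. *)
Lemma nodal_ge k i : (i <= N)%N -> umin <= u k (x_ i).
Proof.
elim: k i => [|k IH] i iN.
  rewrite u_sol.1 ?node_itv// Ih_node//.
  by have /andP[] := u0_bnd (node_itv l_gt0 N_gt0 iN).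
have /andP[e0 _] := ud_left (time_gt0 (ltn0Sn k)).
have /andP[e1 _] := ud_right (time_gt0 (ltn0Sn k)).
have h0 := mesh_gt0 l_gt0 N_gt0.
(* The outer minus sign makes up for the change of sign of the equation under reflection. *)
have S := scheme_nodal (fun x => - Num.max 0 (- u k.+1 x - - umin)) (ltn0Sn k).
rewrite -lerN2.
apply: (@discrete_max R (fun x => - (tau^-1 * beta (- x))) (fun x => - mu (- x)) w_
  (fun i => - u k.+1 (x_ i)) (fun i => - u k (x_ i)) N h alpha (- umin)
  (- ud (time tau k.+1) 0) (- ud (time tau k.+1) l)) => //.
- by move=> x y xy; rewrite lerN2 ler_pM2l ?invr_gt0// betam// lerN2.
- by move=> x y xy; rewrite ltrN2 C1_increasing// ltrN2.
- by rewrite oppr0 mu0 oppr0.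
- by move=> j; exact: weight_ge0.
- by move=> j jN; rewrite lerN2 IH.
- by rewrite lerN2.
- by rewrite lerN2.
rewrite le_eqVlt -[X in _ == X]S; apply/orP; left; apply/eqP; congr (_ + _ + _).
- by apply: eq_bigr => j _; rewrite !opprK; ring.
- apply: eq_bigr => j _; rewrite /slope -mulNr.
  by rewrite opprB !opprK [u k.+1 (x_ j.+1) - _]addrC; ring.
- by congr (_ * _); ring.
Qed.

Lemma nodal_itv k i : (i <= N)%N -> umin <= u k (x_ i) <= umax.
Proof. by move=> iN; rewrite nodal_ge// nodal_le. Qed.

Lemma solution_itv k x : 0 <= x <= l -> umin <= u k x <= umax.
Proof.
move=> xl; rewrite (Vh_interpolation l_gt0 N_gt0 (Vh_solution k) xl).
by apply: Ih_itv => // i iN; exact: nodal_itv.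
Qed.

(* The convex conjugate of primitive0 beta, evaluated at beta a. *)
Let Psi (a : R) := a * beta a - primitive0 beta a.

(** The subgradient inequality of the conjugate, whose subgradient at [beta a] is a. It amounts to
    the tangent inequality for [primitive0 beta] at b. *)
Lemma Psi_le a b : Psi a - Psi b <= (beta a - beta b) * a.
Proof. by have := primitive0_tangent a b betac betam; rewrite /Psi; lra. Qed.

(** Nonnegativity is the tangent inequality at a, evaluated at 0; the upper bound uses the tangent
    at 0, whose slope [beta 0] may be nonzero. *)
Lemma Psi_itv a : umin <= a <= umax ->
  0 <= Psi a <= umax * (beta umax - beta 0).
Proof.
move=> /andP[pa aq]; rewrite /Psi.
have t1 := primitive0_tangent 0 a betac betam.
have t2 := primitive0_tangent a 0 betac betam.
rewrite primitive0_0 in t1 t2; apply/andP; split; first lra.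
have a0 : 0 <= a by exact: le_trans (ltW umin_gt0) pa.
have b1 : beta 0 <= beta a by apply: betam.
have b2 : beta a <= beta umax by apply: betam.
apply: (@le_trans _ _ (a * (beta a - beta 0))); first lra.
by apply: ler_pM; lra.
Qed.

(** Tested with u^k, the time term dominates the increment of the lumped sum of [Psi], and the
    boundary datum contributes at most 2 alpha umax^2 per unit of time. The last summand bounds the
    lumped sum at step 0, as the weights sum to l. *)
Lemma sum_dissipation n : time tau n <= T ->
  \sum_(1 <= k < n.+1) tau * dissipation l alpha mu (u k) <=
  2 * alpha * umax ^+ 2 * T + l * (umax * (beta umax - beta 0)).
Proof.
move=> nT; have umin0 := umin_gt0; pose E k := \sum_(i < N.+1) w_ i * Psi (u k (x_ i)).
have step k : (0 < k)%N -> tau * dissipation l alpha mu (u k) <=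
    tau * (2 * alpha * umax ^+ 2) + (E k.-1 - E k).
  move=> k0; have S := scheme_nodal (u k) k0.
  rewrite /dissipation (ip_slope l_gt0 N_gt0 mu (Vh_solution k) (Vh_solution k)).
  set A := \sum_(i < N) _ in S *.
  have EE : E k - E k.-1 <= tau * \sum_(i < N.+1) w_ i *
      ((tau^-1 * (beta (u k (x_ i)) - beta (u k.-1 (x_ i)))) * u k (x_ i)).
    rewrite /E -sumrB mulr_sumr; apply: ler_sum => i _.
    rewrite -mulrBr mulrCA ler_wpM2l ?weight_ge0// !mulrA mulfV ?gt_eqF// mul1r.
    exact: Psi_le.
  set D := \sum_(i < N.+1) _ in S EE.
  have /andP[e0 e0'] := ud_left (time_gt0 k0).
  have /andP[e1 e1'] := ud_right (time_gt0 k0).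
  have /andP[p0 q0] := nodal_itv k (leq0n N); have /andP[p1 q1] := nodal_itv k (leqnn N).
  rewrite /bdry -{1 2}(node0 l N) -{3 4}(nodeN l N_gt0).
  have b0 : ud (time tau k) 0 * u k (x_ 0) <= umax * umax by apply: ler_pM; lra.
  have b1 : ud (time tau k) l * u k (x_ N) <= umax * umax by apply: ler_pM; lra.
  have bb : alpha * (ud (time tau k) 0 * u k (x_ 0) + ud (time tau k) l * u k (x_ N))
      <= alpha * (2 * umax ^+ 2) by rewrite ler_pM2l//; lra.
  have : tau * (A + alpha * (u k (x_ 0) * u k (x_ 0) + u k (x_ N) * u k (x_ N))) <=
      tau * (alpha * (2 * umax ^+ 2) - D) by rewrite ler_pM2l//; lra.
  lra.
apply: le_trans (telescope_le n step) _.
have En : 0 <= E n.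
  apply: sumr_ge0 => i _; rewrite mulr_ge0 ?weight_ge0//.
  have /andP[-> //] := Psi_itv (nodal_itv n (ltn_ord i : (i <= N)%N)).
have E0 : E 0%N <= l * (umax * (beta umax - beta 0)).
  rewrite -(sum_weight l_gt0 N_gt0) mulr_suml; apply: ler_sum => i _.
  rewrite ler_wpM2l ?weight_ge0//.
  have /andP[_ -> //] := Psi_itv (nodal_itv 0 (ltn_ord i : (i <= N)%N)).
have : n%:R * tau * (2 * alpha * umax ^+ 2) <= T * (2 * alpha * umax ^+ 2).
  have al := ltW alpha_gt0.
  by apply: ler_wpM2r nT; apply: mulr_ge0; [exact: mulr_ge0|exact: sqr_ge0].
lra.
Qed.

(** * The energy estimate *)

Variables (c L J : R) (c_gt0 : 0 < c) (L_ge0 : 0 <= L).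
Hypothesis beta_strong : forall x y, umin <= x <= umax -> umin <= y <= umax ->
  c * (x - y) ^+ 2 <= (beta x - beta y) * (x - y).
Hypothesis ud_lip : forall x s t, x = 0 \/ x = l -> 0 < s -> 0 < t ->
  `|ud s x - ud t x| <= L * `|s - t|.
Hypothesis u0_energy : \sum_(i < N) h * M (slope l N u0 i) <= J.

(* The datum is controlled at positive times only: its first sample serves at 0. *)
Let e k x := ud (time tau (maxn k 1)) x.
(** A boundary energy: its derivative in u is u - e, which is the boundary term of the scheme up to
    the factor alpha. *)
Let G k x := u k x ^+ 2 / 2 - e k x * u k x.

(** The two sides differ by the square (u^k - u^(k-1))^2 / 2, which is dropped, and by the change of
    the datum times u^(k-1), which is the price of summation by parts in time. *)
Lemma boundary_step k x i : (0 < k)%N -> x = 0 \/ x = l -> (i <= N)%N -> x = x_ i ->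
  G k x - G k.-1 x - L * tau * umax <=
  (u k x - ud (time tau k) x) * (u k x - u k.-1 x).
Proof.
move=> k0 xb iN xi; have umin0 := umin_gt0.
have -> : ud (time tau k) x = e k x by rewrite /e (maxn_idPl k0).
have ee : `|e k x - e k.-1 x| <= L * tau.
  apply: (le_trans (ud_lip xb _ _)); rewrite ?time_gt0 ?leq_max ?orbT//.
  rewrite ler_wpM2l// /time -mulrBl normrM (gtr0_norm tau_gt0) ger_pMl//.
  (* For k = 1 both samples of the datum are taken at time tau and coincide. *)
  case: k k0 => // -[|k] _; first by rewrite subrr normr0.
  by rewrite !(maxn_idPl _)//= -natrB// subSnn normr1.
have /andP[p q] := nodal_itv k.-1 iN; rewrite -xi in p q.
have : `|(e k x - e k.-1 x) * u k.-1 x| <= L * tau * umax.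
  by rewrite normrM ler_pM// ger0_norm//; lra.
rewrite ler_norml => /andP[lo hi]; rewrite /G.
have := sqr_ge0 (u k x - u k.-1 x); lra.
Qed.

Let E k := \sum_(i < N) h * M (slope l N (u k) i) + alpha * (G k (x_ 0) + G k (x_ N)).

(** The test function is u^k - u^(k-1). Strong monotonicity of beta bounds the time term from below,
    convexity of M yields the increment of the gradient energy, and [boundary_step] at both ends
    yields the error of order tau. *)
Lemma energy_step k : (0 < k)%N ->
  c * (tau * L2norm_sq l (dtau tau u k)) <=
  tau * (2 * alpha * L * umax) + (E k.-1 - E k).
Proof.
move=> k0; have S := scheme_nodal (fun x => u k x - u k.-1 x) k0.
have h0 := mesh_gt0 l_gt0 N_gt0.
have B0 := boundary_step k0 (or_introl (node0 l N)) (leq0n N) erefl.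
have BN := boundary_step k0 (or_intror (nodeN l N_gt0)) (leqnn N) erefl.
have ud0E : ud (time tau k) (x_ 0) = ud (time tau k) 0 by rewrite (node0 l N).
have udNE : ud (time tau k) (x_ N) = ud (time tau k) l by rewrite (nodeN l N_gt0).
rewrite ud0E in B0; rewrite udNE in BN.
(* The difference quotient equals its interpolant, so the lumped sum bounds its norm. *)
have dI x : 0 <= x <= l -> dtau tau u k x = Ih l N (dtau tau u k) x.
  move=> xl; rewrite {1}/dtau (Vh_interpolation l_gt0 N_gt0 (Vh_solution k) xl).
  rewrite (Vh_interpolation l_gt0 N_gt0 (Vh_solution k.-1) xl).
  by rewrite /Ih -sumrB mulr_sumr; apply: eq_bigr => i _; rewrite /dtau; ring.
have A : c * (tau * L2norm_sq l (dtau tau u k)) <= \sum_(i < N.+1) w_ i *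
    ((tau^-1 * (beta (u k (x_ i)) - beta (u k.-1 (x_ i)))) *
      (u k (x_ i) - u k.-1 (x_ i))).
  apply: (@le_trans _ _ (c * (tau * \sum_(i < N.+1) w_ i * dtau tau u k (x_ i) ^+ 2))).
    by rewrite !ler_pM2l//; exact: L2norm_sq_le.
  rewrite mulrA mulr_sumr; apply: ler_sum => i _.
  rewrite mulrCA ler_wpM2l ?weight_ge0//.
  have -> : c * tau * dtau tau u k (x_ i) ^+ 2 =
      tau^-1 * (c * (u k (x_ i) - u k.-1 (x_ i)) ^+ 2).
    by rewrite /dtau; field; rewrite gt_eqF.
  rewrite -[leRHS]mulrA ler_pM2l ?invr_gt0//.
  by apply: beta_strong; apply: nodal_itv; rewrite -ltnS.
(* The tangent inequality at the new slope, element by element. *)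
have Q : \sum_(i < N) h * M (slope l N (u k) i) -
    \sum_(i < N) h * M (slope l N (u k.-1) i) <=
    \sum_(i < N) mu (slope l N (u k) i) *
      (u k (x_ i.+1) - u k.-1 (x_ i.+1) - (u k (x_ i) - u k.-1 (x_ i))).
  rewrite -sumrB; apply: ler_sum => i _.
  have -> : u k (x_ i.+1) - u k.-1 (x_ i.+1) - (u k (x_ i) - u k.-1 (x_ i)) =
      h * (slope l N (u k) i - slope l N (u k.-1) i).
    by rewrite /slope; field; rewrite gt_eqF.
  rewrite -mulrBr mulrCA ler_pM2l//.
  have := primitive0_tangent (slope l N (u k.-1) i) (slope l N (u k) i) muc mum.
  lra.
have BB : alpha * (G k (x_ 0) - G k.-1 (x_ 0) - L * tau * umax +
      (G k (x_ N) - G k.-1 (x_ N) - L * tau * umax)) <=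
    alpha * ((u k (x_ 0) - ud (time tau k) 0) * (u k (x_ 0) - u k.-1 (x_ 0)) +
      (u k (x_ N) - ud (time tau k) l) * (u k (x_ N) - u k.-1 (x_ N))).
  by rewrite ler_pM2l//; exact: lerD.
rewrite /E; lra.
Qed.

(** The term 3 alpha umax^2 consists of alpha umax^2 from the boundary energy at step 0 and 2 alpha
    umax^2 from its lower bound at step n; the term with T collects the errors of the single
    steps. *)
Lemma sum_energy n : time tau n <= T ->
  c * \sum_(1 <= k < n.+1) tau * L2norm_sq l (dtau tau u k) +
    \int[leb]_(x in `[0, l]) M (derive1 (u n) x) <=
  J + 3 * alpha * umax ^+ 2 + 2 * alpha * L * umax * T.
Proof.
move=> nT; have umin0 := umin_gt0; rewrite mulr_sumr.
have TL := telescope_le n energy_step.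
rewrite (Rintegral_slope l_gt0 N_gt0 M (Vh_solution n)).
have e_itv k x : x = 0 \/ x = l -> umin <= e k x <= umax.
  by move=> xb; apply: ud_bnd => //; rewrite time_gt0// leq_max orbT.
have Gge k i : (i <= N)%N -> x_ i = 0 \/ x_ i = l ->
    - umax ^+ 2 <= G k (x_ i) <= umax ^+ 2 / 2.
  move=> iN xb; have /andP[p q] := nodal_itv k iN; have /andP[p' q'] := e_itv k _ xb.
  have eu : e k (x_ i) * u k (x_ i) <= umax * umax by apply: ler_pM; lra.
  have uu : u k (x_ i) * u k (x_ i) <= umax * umax by apply: ler_pM; lra.
  have eu0 : 0 <= e k (x_ i) * u k (x_ i) by apply: mulr_ge0; lra.
  have := sqr_ge0 (u k (x_ i)); rewrite /G.
  by move=> ?; apply/andP; split; lra.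
have /andP[g0 _] := Gge n 0%N isT (or_introl (node0 l N)).
have /andP[gN _] := Gge n N (leqnn N) (or_intror (nodeN l N_gt0)).
have /andP[_ g0'] := Gge 0%N 0%N isT (or_introl (node0 l N)).
have /andP[_ gN'] := Gge 0%N N (leqnn N) (or_intror (nodeN l N_gt0)).
have an : - (2 * alpha * umax ^+ 2) <= alpha * (G n (x_ 0) + G n (x_ N)).
  have -> : - (2 * alpha * umax ^+ 2) = alpha * (- umax ^+ 2 + - umax ^+ 2) by ring.
  by rewrite ler_pM2l// lerD.
have a0 : alpha * (G 0%N (x_ 0) + G 0%N (x_ N)) <= alpha * umax ^+ 2.
  by rewrite ler_pM2l//; lra.
have E0 : \sum_(i < N) h * M (slope l N (u 0%N) i) <= J.
  apply: le_trans u0_energy; rewrite le_eqVlt; apply/orP; left; apply/eqP.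
  apply: eq_bigr => i _; rewrite /slope.
  by rewrite !u_sol.1 ?Ih_node ?node_itv// ltnW.
have umax0 : 0 <= umax by have /andP[] := nodal_itv 0 (leq0n N); lra.
have : n%:R * tau * (2 * alpha * L * umax) <= T * (2 * alpha * L * umax).
  by have al := ltW alpha_gt0; apply: ler_wpM2r nT; rewrite !mulr_ge0.
rewrite /E in TL; lra.
Qed.

End Scheme.

(** * Energy of the initial datum and the uniform constant *)

(** By the fundamental theorem for weak derivatives, the slope of u0 on an element is the mean of g
    over it, so Jensen's inequality applies there; the resulting bound is free of N. *)
Lemma u0_energy_bound (R : realType) (l : R) (mu u0 g : R -> R) (N : nat) :
  0 < l -> (0 < N)%N -> C1_increasing_away0 mu -> mu 0 = 0 ->
  {within `[0, l], continuous u0} -> weak_derivative 0 l u0 g ->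
  leb.-integrable `]0, l[ (EFin \o (primitive0 mu \o g)) ->
  \sum_(i < N) mesh l N * primitive0 mu (slope l N u0 i) <=
  \int[leb]_(x in `]0, l]) primitive0 mu (g x).
Proof.
move=> l0 N0 mu_incr mu0 uc ug Mi; have [_ [mg _ _] _] := ug.
have gi := integrable_of_primitive0 mu_incr mu0 mg Mi.
have oc f : leb.-integrable `]0, l[ (EFin \o f) -> leb.-integrable `]0, l] (EFin \o f).
  by move=> /integrable_itv_cc; apply: integrableS => //; exact: subset_itv_oc_cc.
have := @jensen_partition _ mu mu_incr mu0 (node l N) l N g u0.
rewrite node0; move=> /(_ _ _ (oc _ gi) (oc _ Mi)) H.
have dE i : node l N i.+1 - node l N i = mesh l N by rewrite nodeS; ring.
apply: le_trans (H _ _ _) => [|i _||i iN].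
- by under [leRHS]eq_bigr do rewrite dE.
- exact: node_lt.
- by rewrite nodeN.
- apply: (weak_derivative_ftc uc gi ug).
  + by have /andP[] := node_itv l0 N0 (ltnW iN).
  + by rewrite ltW// node_lt.
  + by have /andP[] := node_itv l0 N0 iN.
Qed.

Unset Implicit Arguments.

Theorem theorem6 (R : realType) (l alpha T : R) (beta mu u0 : R -> R)
    (ud : R -> R -> R) (umin umax : R)
    (l_gt0 : 0 < l) (alpha_gt0 : 0 < alpha) (T_gt0 : 0 < T)
    (beta_incr : C1_increasing_away0 beta)
    (B_coercive : coercive (primitive0 beta))
    (mu_incr : C1_increasing_away0 mu) (mu0 : mu 0 = 0)
    (u0_reg : initial_datum l mu u0)
    (ud_reg : boundary_datum l ud)
    (umin_gt0 : 0 < umin) (umax_gt0 : 0 < umax)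
    (u0_bnd : forall x, 0 <= x <= l -> umin <= u0 x <= umax)
    (ud_bnd : forall t x, 0 < t -> x = 0 \/ x = l ->
      umin <= ud t x <= umax) :
  exists C : R, forall (N : nat) (tau : R) (u : nat -> R -> R),
    (0 < N)%N -> 0 < tau ->
    discrete_solution l alpha beta mu u0 ud N tau u ->
    [/\ forall k, time tau k <= T ->
          forall x, 0 <= x <= l -> umin <= u k x <= umax,
        \sum_(1 <= k < (last_step T tau).+1)
          tau * dissipation l alpha mu (u k) <= C,
        \sum_(1 <= k < (last_step T tau).+1)
          tau * L2norm_sq l (dtau tau u k) <= C &
        forall k, time tau k <= T ->
          \int[leb]_(x in `[0, l]) primitive0 mu (derive1 (u k) x) <= C].
Proof.
have lend : l = 0 \/ l = l by right.
(* One sample of the datum shows umin <= umax. *)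
have /andP[um1 um2] := ud_bnd 1 0 ltr01 (or_introl erefl).
have umM := le_trans um1 um2.
have [c c0 cP] := strongly_monotone beta_incr umin_gt0 umM.
have [_ /lipschitz_onP[L0 L0_ge0 L0P]] := ud_reg 0 (or_introl erefl).
have [_ /lipschitz_onP[L1 L1_ge0 L1P]] := ud_reg l lend.
(* The sum serves as a common Lipschitz constant for both end points. *)
pose L := L0 + L1; have L_ge0 : 0 <= L by exact: addr_ge0.
have LP x s t : x = 0 \/ x = l -> 0 < s -> 0 < t -> `|ud s x - ud t x| <= L * `|s - t|.
  move=> xb s0 t0.
  have s0' : `]0, +oo[%classic s by rewrite /= in_itv/= s0.
  have t0' : `]0, +oo[%classic t by rewrite /= in_itv/= t0.
  case: xb => ->.
    by rewrite (le_trans (L0P s t s0' t0'))// ler_wpM2r// lerDl.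
  by rewrite (le_trans (L1P s t s0' t0'))// ler_wpM2r// lerDr.
have [_ uc [g ug Mi]] := u0_reg.
have [muc _] := mu_incr; have mum := C1_increasing_le mu_incr.
set J := \int[leb]_(x in `]0, l]) primitive0 mu (g x).
have J0 : 0 <= J by apply: Rintegral_ge0 => x _; exact: primitive0_ge0.
pose C0 := 2 * alpha * umax ^+ 2 * T + l * (umax * (beta umax - beta 0)).
pose C1 := J + 3 * alpha * umax ^+ 2 + 2 * alpha * L * umax * T.
have C0_ge0 : 0 <= C0.
  have b0 : 0 <= beta umax - beta 0.
    by rewrite subr_ge0 (C1_increasing_le beta_incr)// ltW.
  have aT : 0 <= alpha * T by rewrite mulr_ge0// ltW.
  have b1 : 0 <= l * (umax * (beta umax - beta 0)) by rewrite !mulr_ge0// ltW.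
  have := mulr_ge0 aT (sqr_ge0 umax); rewrite /C0; lra.
have C1_ge0 : 0 <= C1.
  have a1 : 0 <= alpha * umax ^+ 2 by rewrite mulr_ge0 ?sqr_ge0// ltW.
  have : 0 <= alpha * L * umax * T by rewrite !mulr_ge0// ltW.
  by rewrite /C1; lra.
have C1c_ge0 : 0 <= C1 / c by rewrite divr_ge0// ltW.
have C0_le : C0 <= C0 + C1 + C1 / c by lra.
have C1_le : C1 <= C0 + C1 + C1 / c by lra.
have C1c_le : C1 / c <= C0 + C1 + C1 / c by lra.
(* The three summands are nonnegative, so the sum dominates each of them; none depends on N, tau or
   u. *)
exists (C0 + C1 + C1 / c) => N tau u N0 tau0 us.
have Je := u0_energy_bound l_gt0 N0 mu_incr mu0 uc ug Mi.
have lastT : time tau (last_step T tau) <= T by rewrite -last_stepP// ltW.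
have Edis := sum_dissipation l_gt0 alpha_gt0 beta_incr mu_incr mu0 umin_gt0 u0_bnd
  ud_bnd N0 tau0 us lastT.
have Een n (nT : time tau n <= T) := sum_energy l_gt0 alpha_gt0 beta_incr mu_incr mu0
  umin_gt0 u0_bnd ud_bnd N0 tau0 us c0 L_ge0 cP LP Je nT.
have M0 n : 0 <= \int[leb]_(x in `[0, l]) primitive0 mu (derive1 (u n) x).
  by apply: Rintegral_ge0 => x _; exact: primitive0_ge0.
have S0 n : 0 <= \sum_(1 <= k < n.+1) tau * L2norm_sq l (dtau tau u k).
  apply: sumr_ge0 => k _; rewrite mulr_ge0 ?(ltW tau0)//.
  by apply: Rintegral_ge0 => x _; rewrite -expr2 sqr_ge0.
split.
- by move=> k _ x xl; exact: (solution_itv l_gt0 alpha_gt0 beta_incr mu_incr mu0 u0_bnd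
    ud_bnd N0 tau0 us).
- exact: le_trans Edis C0_le.
(* The energy estimate bounds c times the sum of the norms plus the energy at the final step.
   Dropping the nonnegative energy here, and the nonnegative sum in the last item, gives both
   bounds. *)
- apply: le_trans C1c_le; rewrite ler_pdivlMr// mulrC.
  apply: le_trans (Een _ lastT); rewrite lerDl; exact: M0.
- move=> k kT; apply: le_trans C1_le; apply: le_trans (Een k kT).
  by rewrite lerDr mulr_ge0// ltW.
Qed.
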